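(* Suppose there exist $x\in V_p\cap\operatorname{int}K_p$ and $s\in V_d\cap\operatorname{int}K_d$, that $c\in\mathcal L=\operatorname{Null}(A)$, and that rPDHG is run from $z^{0,0}=(x^{0,0},y^{0,0})=(0,0)$ using the $\beta$-restart condition with $\beta:=1/e$ and the step-sizes $\tau=\tau_0:=1/\kappa$ and $\sigma=\sigma_0:=1/(\lambda_{\max}\lambda_{\min})$. Given $\varepsilon_{\mathrm{cons}},\varepsilon_{\mathrm{gap}}>0$, let $T$ be the total number of OnePDHG iterations that are run in order to obtain (the first) $n$ for which $w^{n,0}=(x^{n,0},s^{n,0})$ satisfies $\mathrm{E}_{\mathrm{cons}}(w^{n,0})\le\varepsilon_{\mathrm{cons}}$ and $\mathrm{E}_{\mathrm{gap}}(w^{n,0})\le\varepsilon_{\mathrm{gap}}$. Then $$T\le99\,\kappa\left(\liminf_{\delta\searrow0}\frac{D_\delta}{r_\delta}\right)\ln\left(17\,\kappa\,\operatorname{Dist}(0,\mathcal W^\star)\Big(\frac1{\varepsilon_{\mathrm{cons}}}\vee\frac{2\sqrt2\,\operatorname{Dist}(0,\mathcal W^\star)}{\varepsilon_{\mathrm{gap}}}\Big)\right).$$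
   Context: Problem. $K_p\subseteq\mathbb R^n$ is a closed convex cone, $K_d:=K_p^*=\{s:x^\top s\ge0\ \forall x\in K_p\}$, $A\in\mathbb R^{m\times n}$ ($A\ne0$, rows not assumed independent), $b\in\mathbb R^m$, $c\in\mathbb R^n$. The primal problem is $\min\{c^\top x:Ax=b,x\in K_p\}$. $\|\cdot\|$ is the Euclidean norm, $\operatorname{Dist}$ is Euclidean distance to a set, $B(w,r)$ is the Euclidean ball, $a\vee b=\max\{a,b\}$. $\mathcal L:=\operatorname{Null}(A)$, $\mathcal L^\perp=\operatorname{Im}(A^\top)$, $q:=A^\top(AA^\top)^\dagger b$ (Moore-Penrose inverse), $V_p:=\{x:Ax=b\}$, $V_d:=c+\operatorname{Im}(A^\top)$, $V:=V_p\times V_d$, $K:=K_p\times K_d$, $\mathcal F:=V\cap K$. For $w=(x,s)\in\mathbb R^{2n}$, and with $c\in\mathcal L$, $\operatorname{Gap}(w):=c^\top x+q^\top s$. $\mathcal W^\star:=\mathcal F\cap\{w:\operatorname{Gap}(w)=0\}$. $\lambda_{\max},\lambda_{\min}$ are the largest and smallest positive singular values of $A$, and $\kappa:=\lambda_{\max}/\lambda_{\min}$. Level-set measures. For $\delta>0$: $\mathcal W_\delta:=\mathcal F\cap\{w:\operatorname{Gap}(w)\le\delta\}$; diameter $D_\delta:=\max_{u,v\in\mathcal W_\delta}\|u-v\|$; conic radius $r_\delta:=\max\{r\ge0: w\in\mathcal W_\delta,\ B(w,r)\subseteq K\}$ (maximum over $w$ and $r$). Errors. $\mathrm{E}_{\mathrm{cons}}(w):=\max\{\operatorname{Dist}(w,V),\operatorname{Dist}(w,K)\}$,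 $\mathrm{E}_{\mathrm{gap}}(w):=\max\{0,\operatorname{Gap}(w)\}$. Algorithm. $L(x,y):=c^\top x+b^\top y-x^\top A^\top y$. For $z=(x,y)$, OnePDHG$(z)=(x^+,y^+)$ with $x^+=P_{K_p}(x-\tau(c-A^\top y))$ (Euclidean projection), $y^+=y+\sigma(b-A(2x^+-x))$. With $M:=\begin{pmatrix}\frac1\tau I_n & A^\top \\ A & \frac1\sigma I_m\end{pmatrix}\succeq0$, $\|z\|_M:=\sqrt{z^\top Mz}$. The normalized duality gap of $z=(x,y)\in K_p\times\mathbb R^m$ is, for $r>0$, $\rho(r;z):=\frac1r\sup\{L(x,\hat y)-L(\hat x,y):\hat x\in K_p,\ \|(\hat x,\hat y)-z\|_M\le r\}$. rPDHG: for outer iterations $n=0,1,2,\dots$, set $z^{n,k+1}=\text{OnePDHG}(z^{n,k})$ and $\bar z^{n,k}=\frac1k\sum_{i=1}^kz^{n,i}$ for $k\ge1$; at the first $k\ge1$ for which $(n,k)$ satisfies the restart condition, set $z^{n+1,0}:=\bar z^{n,k}$ and pass to outer iteration $n+1$. The $\beta$-restart condition ($\beta\in(0,1)$) holds at $(n,k)$ if $n=0$ and $k=1$, or if $n\ge1$ and $\rho(\|\bar z^{n,k}-z^{n,0}\|_M;\bar z^{n,k})\le\beta\,\rho(\|z^{n,0}-z^{n-1,0}\|_M;z^{n,0})$. Write $z^{n,k}=(x^{n,k},y^{n,k})$, $s^{n,k}:=c-A^\top y^{n,k}$, $w^{n,k}:=(x^{n,k},s^{n,k})$.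
   Formalization: The bound proved is T ≤ max{0, right-hand side}: for very large tolerances the initial point is already accepted, so T = 0 while the logarithm, and hence the stated bound, is negative; whenever the stated bound is nonnegative nothing changes. *)

(* Defs.v *)
From HB Require Import structures.
From mathcomp Require Import all_boot all_order all_algebra.
From mathcomp Require Import all_classical all_reals all_analysis.

Set Implicit Arguments.
Unset Strict Implicit.
Unset Printing Implicit Defensive.

Import Order.TTheory GRing.Theory Num.Theory.
Import numFieldNormedType.Exports.

Local Open Scope classical_set_scope.
Local Open Scope ring_scope.

(* MathComp-Analysis norms matrices by the maximum of the entries, so the
   Euclidean norm is defined here; the two norms induce the same topology, and
   [closed] and [interior] below are the library's. *)
Section euclidean.
Context {R : realType}.

Definition dotv k (u v : 'cV[R]_k) : R := (u^T *m v) 0 0.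

Definition enorm k (v : 'cV[R]_k) : R := Num.sqrt (dotv v v).

Definition eball k (w : 'cV[R]_k) (r : R) : set 'cV[R]_k :=
  [set v | enorm (v - w) <= r].

Definition dist k (w : 'cV[R]_k) (S : set 'cV[R]_k) : R :=
  inf [set enorm (w - v) | v in S].

Definition eproj k (S : set 'cV[R]_k) (w : 'cV[R]_k) : 'cV[R]_k :=
  xget 0 [set p | S p /\ forall v, S v -> enorm (w - p) <= enorm (w - v)].

Definition convex_cone k (S : set 'cV[R]_k) : Prop :=
  convex_set S /\ forall (a : R) x, 0 <= a -> S x -> S (a *: x).

Definition dual_cone k (S : set 'cV[R]_k) : set 'cV[R]_k :=
  [set s | forall x, S x -> 0 <= dotv x s].

Definition penrose k l (M : 'M[R]_(k, l)) (X : 'M[R]_(l, k)) : Prop :=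
  [/\ M *m X *m M = M, X *m M *m X = X,
      (M *m X)^T = M *m X & (X *m M)^T = X *m M].

(* The library's [pinvmx] is a generalized inverse that need not be the
   Moore-Penrose one. *)
Definition mp_inverse k l (M : 'M[R]_(k, l)) : 'M[R]_(l, k) :=
  xget 0 [set X | penrose M X].

Definition pos_singular_values k l (M : 'M[R]_(k, l)) : set R :=
  [set a | 0 < a /\ eigenvalue (M^T *m M) (a ^+ 2)].

(* The set of positive singular values is finite, and nonempty when M != 0, so
   the supremum and the infimum are a maximum and a minimum. *)
Definition lambda_max k l (M : 'M[R]_(k, l)) : R := sup (pos_singular_values M).
Definition lambda_min k l (M : 'M[R]_(k, l)) : R := inf (pos_singular_values M).

Definition kappa k l (M : 'M[R]_(k, l)) : R := lambda_max M / lambda_min M.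

End euclidean.

(* Primal-dual pairs w = (x, s) and z = (x, y) are stacked columns
   [col_mx x s] and [col_mx x y], read back with [usubmx] and [dsubmx]. *)
Section cone_program.
Context {R : realType} {m n : nat}.
Variables (A : 'M[R]_(m, n)) (b : 'cV[R]_m) (c : 'cV[R]_n).
Variable Kp : set 'cV[R]_n.

Definition Kd : set 'cV[R]_n := dual_cone Kp.

Definition qvec : 'cV[R]_n := A^T *m mp_inverse (A *m A^T) *m b.

Definition Vp : set 'cV[R]_n := [set x | A *m x = b].
Definition Vd : set 'cV[R]_n := [set s | exists y : 'cV[R]_m, s = c + A^T *m y].

Definition Vpd : set 'cV[R]_(n + n) := [set w | Vp (usubmx w) /\ Vd (dsubmx w)].
Definition Kpd : set 'cV[R]_(n + n) := [set w | Kp (usubmx w) /\ Kd (dsubmx w)].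
Definition feasible : set 'cV[R]_(n + n) := Vpd `&` Kpd.

Definition Gap (w : 'cV[R]_(n + n)) : R :=
  dotv c (usubmx w) + dotv qvec (dsubmx w).

Definition Wstar : set 'cV[R]_(n + n) := feasible `&` [set w | Gap w = 0].
Definition Wlevel (d : R) : set 'cV[R]_(n + n) :=
  feasible `&` [set w | Gap w <= d].

Definition diam_level (d : R) : \bar R :=
  ereal_sup [set (enorm (p.1 - p.2))%:E | p in Wlevel d `*` Wlevel d].

Definition conic_radius (d : R) : \bar R :=
  ereal_sup [set r%:E | r in [set r : R |
    0 <= r /\ exists2 w, Wlevel d w & eball w r `<=` Kpd]].

Definition liminf_level_ratio : \bar R :=
  limf_einf (fun d : R => (diam_level d / conic_radius d)%E) 0^'+.

Definition Econs (w : 'cV[R]_(n + n)) : R := Num.max (dist w Vpd) (dist w Kpd).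
Definition Egap (w : 'cV[R]_(n + n)) : R := Num.max 0 (Gap w).

Definition Lagr (x : 'cV[R]_n) (y : 'cV[R]_m) : R :=
  dotv c x + dotv b y - dotv x (A^T *m y).

Variables tau sigma : R.

Definition onePDHG (z : 'cV[R]_(n + m)) : 'cV[R]_(n + m) :=
  let x := usubmx z in
  let y := dsubmx z in
  let x' := eproj Kp (x - tau *: (c - A^T *m y)) in
  let y' := y + sigma *: (b - A *m (2 *: x' - x)) in
  col_mx x' y'.

Definition Mmx : 'M[R]_(n + m) :=
  block_mx (tau^-1)%:M A^T A (sigma^-1)%:M.

Definition normM (z : 'cV[R]_(n + m)) : R := Num.sqrt (dotv z (Mmx *m z)).

(* At r = 0 this definition gives 0 because 0^-1 = 0 and 0 * +oo = 0.  At a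
   saddle point z of [Lagr] that is also the value for every r > 0, and in the
   restart test below the radius vanishes only at saddle points. *)
Definition rho (r : R) (z : 'cV[R]_(n + m)) : \bar R :=
  ((r^-1)%:E * ereal_sup
    [set (Lagr (usubmx z) (dsubmx zh) - Lagr (usubmx zh) (dsubmx z))%:E
      | zh in [set zh : 'cV[R]_(n + m) |
                 Kp (usubmx zh) /\ (normM (zh - z) <= r)%R]])%E.

Definition average (z0 : 'cV[R]_(n + m)) (k : nat) : 'cV[R]_(n + m) :=
  k%:R^-1 *: \sum_(1 <= i < k.+1) iter i onePDHG z0.

Variable beta : R.

(* The restart test at (N, k), where zp = z^{N-1,0} (unused when N = 0) and
   z0 = z^{N,0}. *)
Definition restart (N : nat) (zp z0 : 'cV[R]_(n + m)) (k : nat) : Prop :=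
  (N = 0%N /\ k = 1%N) \/
  ((1 <= N)%N /\
   (rho (normM (average z0 k - z0)%R) (average z0 k)
      <= beta%:E * rho (normM (z0 - zp)%R) z0)%E).

Definition first_restart (N : nat) (zp z0 : 'cV[R]_(n + m)) (k : nat) : Prop :=
  [/\ (1 <= k)%N, restart N zp z0 k &
      forall j, (1 <= j < k)%N -> ~ restart N zp z0 j].

(* [rPDHG zinit N zp z t]: outer iteration N is reached after t calls of
   [onePDHG] in total, with z^{N,0} = z and, if N >= 1, z^{N-1,0} = zp. *)
Inductive rPDHG (zinit : 'cV[R]_(n + m)) :
  nat -> 'cV[R]_(n + m) -> 'cV[R]_(n + m) -> nat -> Prop :=
| rPDHG_init : rPDHG zinit 0 zinit zinit 0
| rPDHG_restart N zp z t k :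
    rPDHG zinit N zp z t -> first_restart N zp z k ->
    rPDHG zinit N.+1 z (average z k) (t + k)%N.

(* The number of [onePDHG] calls made when the first outer iteration N with
   [stop z^{N,0}] is reached. The set has at most one element; the value is +oo
   if there is no such N. *)
Definition iteration_count (zinit : 'cV[R]_(n + m))
    (stop : set 'cV[R]_(n + m)) : \bar R :=
  ereal_inf [set (t%:R)%:E | t in [set t : nat |
    exists N zp z, [/\ rPDHG zinit N zp z t, stop z &
      forall N' zp' z' t', (N' < N)%N -> rPDHG zinit N' zp' z' t' ->
        ~ stop z']]].

End cone_program.

(* w = (x, c - A^T y) for z = (x, y) *)
Definition slack_point {R : realType} {m n : nat} (A : 'M[R]_(m, n))
    (c : 'cV[R]_n) (z : 'cV[R]_(n + m)) : 'cV[R]_(n + n) :=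
  col_mx (usubmx z) (c - A^T *m dsubmx z).

(* Main.v *)
(* For the given step sizes the M-norm of a difference z - z' is at most
   sqrt(2 kappa) times the Euclidean norm of w - w'.  The PDHG descent inequality
   shows that the average of k iterates started at z has normalized duality gap
   at most 2/k times its M-distance to z, hence at most 4/k times the M-distance
   from z to any saddle point.  Conversely, a normalized duality gap p forces
   feasibility residuals at most sqrt(kappa) p and, since M-distances to a saddle
   point never increase and the run starts at 0, an objective gap at most
   2 sqrt(2 kappa) p Dist(0, W* ).  A ball B(w, r) in the cone with w in a level
   set W_d satisfies r Dist(0, W* ) <= d, so combining a nearly feasible point with
   the center of such a ball and an optimal point gives, as d tends to 0,
   Dist(w, W* ) <= (3 sqrt 2 liminf(D_d / r_d) + 1) sqrt(kappa) p.
   The two estimates together bound the number of inner iterations that divide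
   the gap by e, and log-many such divisions reach the tolerances.  Saddle points
   exist because the averages of PDHG are bounded by the Slater points. *)

Require Import Defs.
From mathcomp Require Import all_boot all_order all_algebra.
From mathcomp Require Import all_classical all_reals all_analysis.
From mathcomp Require Import ring lra.
Set Implicit Arguments.
Unset Strict Implicit.
Unset Printing Implicit Defensive.

Import Order.TTheory GRing.Theory Num.Theory.
Import numFieldNormedType.Exports.
Local Open Scope classical_set_scope.
Local Open Scope ring_scope.

(** * Euclidean geometry *)

(** The step sizes satisfy [tau * sigma * lambda_max ^ 2 = 1], so the M-form is only semidefinite: a
    zero restart radius does not identify two points. Optimality of a zero-radius average is
    therefore derived from a gap bound that is quadratic along segments. Since the rows of [A] may
    be dependent, a slack fixes its multiplier only modulo Null(A^T); the dual iterates are tracked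
    inside the range of [A], where [lambda_min] bounds [y] by [A^T y]. The geometry rests on one
    orthogonality: differences in the two affine spaces lie in Null(A) and Im(A^T), so the cross
    pairing of two affine points is the sum of their gaps. The resulting inequality between radius,
    level and norm of an optimal point is what keeps the error bound finite: the gap excess divided
    by [d] would blow up as [d] tends to 0, but it is at most a multiple of [1 / r], which the ratio
    [D / r] absorbs. The liminf need be neither attained nor finite. Any real above it is beaten at
    arbitrarily small levels, and compactness carries the bound to the optimal set. *)

Section dotv_algebra.
Context {R : realType}.

Lemma dotvE k (u v : 'cV[R]_k) : dotv u v = \sum_i u i 0 * v i 0.
Proof. by rewrite /dotv mxE; apply: eq_bigr => i _; rewrite mxE. Qed.

Lemma dotvC k (u v : 'cV[R]_k) : dotv u v = dotv v u.
Proof. by rewrite !dotvE; apply: eq_bigr => i _; rewrite mulrC. Qed.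

Lemma dotvDr k (u v w : 'cV[R]_k) : dotv u (v + w) = dotv u v + dotv u w.
Proof. by rewrite /dotv mulmxDr mxE. Qed.

Lemma dotvDl k (u v w : 'cV[R]_k) : dotv (v + w) u = dotv v u + dotv w u.
Proof. by rewrite !(dotvC _ u) dotvDr. Qed.

Lemma dotvZr k a (u v : 'cV[R]_k) : dotv u (a *: v) = a * dotv u v.
Proof. by rewrite /dotv -scalemxAr mxE. Qed.

Lemma dotvZl k a (u v : 'cV[R]_k) : dotv (a *: v) u = a * dotv v u.
Proof. by rewrite !(dotvC _ u) dotvZr. Qed.

Lemma dotvNr k (u v : 'cV[R]_k) : dotv u (- v) = - dotv u v.
Proof. by rewrite -scaleN1r dotvZr mulN1r. Qed.

Lemma dotvNl k (u v : 'cV[R]_k) : dotv (- v) u = - dotv v u.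
Proof. by rewrite !(dotvC _ u) dotvNr. Qed.

Lemma dotv0r k (u : 'cV[R]_k) : dotv u 0 = 0.
Proof. by rewrite /dotv mulmx0 mxE. Qed.

Lemma dotv0l k (u : 'cV[R]_k) : dotv 0 u = 0.
Proof. by rewrite dotvC dotv0r. Qed.

Definition dotv_lin := (dotvDr, dotvDl, dotvNr, dotvNl, dotvZr, dotvZl,
  dotv0r, dotv0l).

Lemma dotv_mulmxl k l (M : 'M[R]_(k, l)) u v :
  dotv (M *m u) v = dotv u (M^T *m v).
Proof. by rewrite /dotv trmx_mul mulmxA. Qed.

Lemma dotv_mulmxr k l (M : 'M[R]_(k, l)) u v :
  dotv u (M *m v) = dotv (M^T *m u) v.
Proof. by rewrite dotv_mulmxl trmxK. Qed.

Lemma dotv_col_mx k l (a b : 'cV[R]_k) (c d : 'cV[R]_l) :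
  dotv (col_mx a c) (col_mx b d) = dotv a b + dotv c d.
Proof. by rewrite /dotv tr_col_mx mul_row_col mxE. Qed.

Lemma dotv_ge0 k (v : 'cV[R]_k) : 0 <= dotv v v.
Proof. by rewrite dotvE; apply: sumr_ge0 => i _; rewrite -expr2 sqr_ge0. Qed.

Lemma dotv_eq0 k (v : 'cV[R]_k) : dotv v v = 0 -> v = 0.
Proof.
rewrite dotvE => /psumr_eq0P v0; apply/colP => i; rewrite mxE.
apply/eqP; rewrite -sqrf_eq0 expr2; apply/eqP.
by apply: v0 => // j _; rewrite -expr2 sqr_ge0.
Qed.


(** The case [c = 0] is kept because the M-form is degenerate; there [t = - (a + 1) / (2 * b)] would
    give the value -1 unless [b = 0]. *)
Lemma discriminant_le0 (a b c : R) : 0 <= c ->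
  (forall t, 0 <= a + 2 * t * b + t ^+ 2 * c) -> b ^+ 2 <= a * c.
Proof.
move=> c0 h; have [c1|c1] := eqVneq c 0.
  rewrite c1 mulr0; suff -> : b = 0 by rewrite expr0n.
  apply/eqP; apply: contraT => b0.
  have := h (- (a + 1) / (2 * b)); rewrite c1.
  suff -> : a + 2 * (- (a + 1) / (2 * b)) * b +
     (- (a + 1) / (2 * b)) ^+ 2 * 0 = -1 by rewrite lerNr oppr0 ler10.
  by field.
have {}c0 : 0 < c by rewrite lt_def c1.
have := h (- b / c).
have -> : a + 2 * (- b / c) * b + (- b / c) ^+ 2 * c = (a * c - b ^+ 2) / c.
  by field.
by rewrite pmulr_lge0 ?invr_gt0// subr_ge0.
Qed.

(** Kept for a general form so that one Cauchy-Schwarz and one triangle inequality serve both the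
    Euclidean norm, [S = 1], and the degenerate M-norm. *)
Definition psd k (S : 'M[R]_k) := S^T = S /\ forall v, 0 <= dotv v (S *m v).

Definition seminorm k (S : 'M[R]_k) v := Num.sqrt (dotv v (S *m v)).

Lemma psd_sym k (S : 'M[R]_k) u v : psd S -> dotv u (S *m v) = dotv v (S *m u).
Proof. by case=> St _; rewrite dotv_mulmxr St dotvC. Qed.

Lemma seminorm_ge0 k (S : 'M[R]_k) v : 0 <= seminorm S v.
Proof. exact: sqrtr_ge0. Qed.

Lemma sqr_seminorm k (S : 'M[R]_k) v :
  psd S -> seminorm S v ^+ 2 = dotv v (S *m v).
Proof. by case=> _ p; rewrite sqr_sqrtr. Qed.

Lemma psd_expand k (S : 'M[R]_k) u v t : psd S ->
  dotv (u + t *: v) (S *m (u + t *: v)) =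
  dotv u (S *m u) + 2 * t * dotv u (S *m v) + t ^+ 2 * dotv v (S *m v).
Proof.
move=> p; rewrite mulmxDr -scalemxAr !dotv_lin (psd_sym v u p); ring.
Qed.

Lemma seminorm_CS k (S : 'M[R]_k) u v : psd S ->
  dotv u (S *m v) <= seminorm S u * seminorm S v.
Proof.
move=> p; have [_ p0] := p.
rewrite -sqrtrM// (le_trans (ler_norm _))// -sqrtr_sqr ler_sqrt ?mulr_ge0//.
apply: discriminant_le0 => // t; rewrite -psd_expand//.
Qed.

(** The discriminant inequality with vanishing first coefficient. It turns an extremal vector of a
    Rayleigh quotient into an eigenvector. *)
Lemma psd_kernel k (S : 'M[R]_k) u v : psd S -> dotv u (S *m u) = 0 ->
  dotv u (S *m v) = 0.
Proof.
move=> p u0; have [_ p0] := p.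
apply/eqP; rewrite -sqrf_eq0 eq_le sqr_ge0 andbT.
rewrite -(mul0r (dotv v (S *m v))) -u0.
by apply: discriminant_le0 => // t; rewrite -psd_expand.
Qed.

Lemma seminormD k (S : 'M[R]_k) u v : psd S ->
  seminorm S (u + v) <= seminorm S u + seminorm S v.
Proof.
move=> p; rewrite -(@ler_pXn2r _ 2)// ?nnegrE ?addr_ge0 ?seminorm_ge0//.
rewrite sqr_seminorm// -[v]scale1r psd_expand// scale1r.
rewrite sqrrD !sqr_seminorm// expr1n mul1r mulr1 lerD2r lerD2l.
by have := seminorm_CS u v p; rewrite mulr2n; lra.
Qed.

Lemma seminormZ k (S : 'M[R]_k) a u : psd S ->
  seminorm S (a *: u) = `|a| * seminorm S u.
Proof.
move=> p; rewrite /seminorm -scalemxAr !dotv_lin mulrA -expr2.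
by rewrite sqrtrM ?sqr_ge0// sqrtr_sqr.
Qed.

Lemma psd1 k : psd (1%:M : 'M[R]_k).
Proof. by split=> [|v]; rewrite ?trmx1// mul1mx dotv_ge0. Qed.

Lemma enormE k (v : 'cV[R]_k) : enorm v = seminorm 1%:M v.
Proof. by rewrite /seminorm mul1mx. Qed.

Lemma enorm_ge0 k (v : 'cV[R]_k) : 0 <= enorm v.
Proof. exact: sqrtr_ge0. Qed.

Lemma sqr_enorm k (v : 'cV[R]_k) : enorm v ^+ 2 = dotv v v.
Proof. by rewrite sqr_sqrtr ?dotv_ge0. Qed.

Lemma enorm0 k : enorm (0 : 'cV[R]_k) = 0.
Proof. by rewrite /enorm dotv0l sqrtr0. Qed.

Lemma enorm_eq0 k (v : 'cV[R]_k) : enorm v = 0 -> v = 0.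
Proof. by move=> v0; apply: dotv_eq0; rewrite -sqr_enorm v0 expr0n. Qed.

Lemma enorm_le k l (u : 'cV[R]_k) (v : 'cV[R]_l) :
  (enorm u <= enorm v) = (dotv u u <= dotv v v).
Proof. by rewrite /enorm ler_sqrt ?dotv_ge0. Qed.

Lemma enormD k (u v : 'cV[R]_k) : enorm (u + v) <= enorm u + enorm v.
Proof. by rewrite !enormE; apply/seminormD/psd1. Qed.

Lemma enormZ k a (u : 'cV[R]_k) : enorm (a *: u) = `|a| * enorm u.
Proof. by rewrite !enormE; apply/seminormZ/psd1. Qed.

Lemma enormN k (u : 'cV[R]_k) : enorm (- u) = enorm u.
Proof. by rewrite -scaleN1r enormZ normrN1 mul1r. Qed.

Lemma enormB k (u v : 'cV[R]_k) : enorm (u - v) = enorm (v - u).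
Proof. by rewrite -enormN opprB. Qed.

Lemma dotv_CS k (u v : 'cV[R]_k) : dotv u v <= enorm u * enorm v.
Proof. by have := seminorm_CS u v (psd1 k); rewrite mul1mx -!enormE. Qed.

Lemma enorm_triangle k (u v w : 'cV[R]_k) :
  enorm (u - w) <= enorm (u - v) + enorm (v - w).
Proof. by rewrite (le_trans _ (enormD _ _))// addrA subrK. Qed.

Lemma sqr_enorm_col k l (u : 'cV[R]_k) (v : 'cV[R]_l) :
  enorm (col_mx u v) ^+ 2 = enorm u ^+ 2 + enorm v ^+ 2.
Proof. by rewrite !sqr_enorm dotv_col_mx. Qed.

Lemma enorm_colu k l (u : 'cV[R]_k) (v : 'cV[R]_l) :
  enorm u <= enorm (col_mx u v).
Proof.
by rewrite -(@ler_pXn2r _ 2)// ?nnegrE ?enorm_ge0// sqr_enorm_col lerDl sqr_ge0.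
Qed.

Lemma enorm_cold k l (u : 'cV[R]_k) (v : 'cV[R]_l) :
  enorm v <= enorm (col_mx u v).
Proof.
by rewrite -(@ler_pXn2r _ 2)// ?nnegrE ?enorm_ge0// sqr_enorm_col lerDr sqr_ge0.
Qed.

Lemma enorm_usub k l (w : 'cV[R]_(k + l)) : enorm (usubmx w) <= enorm w.
Proof. by rewrite -[in leRHS](vsubmxK w) enorm_colu. Qed.

Lemma enorm_dsub k l (w : 'cV[R]_(k + l)) : enorm (dsubmx w) <= enorm w.
Proof. by rewrite -[in leRHS](vsubmxK w) enorm_cold. Qed.

Lemma enorm_col_le k l (u : 'cV[R]_k) (v : 'cV[R]_l) :
  enorm (col_mx u v) <= enorm u + enorm v.
Proof.
rewrite -(@ler_pXn2r _ 2)// ?nnegrE ?addr_ge0 ?enorm_ge0// sqr_enorm_col.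
by rewrite sqrrD lerD2r lerDl mulrn_wge0// mulr_ge0 ?enorm_ge0.
Qed.

Lemma coord_le_enorm k (v : 'cV[R]_k) i : `|v i 0| <= enorm v.
Proof.
rewrite -(@ler_pXn2r _ 2)// ?nnegrE ?enorm_ge0// sqr_enorm dotvE.
rewrite (bigD1 i)//= -normrX ger0_norm ?sqr_ge0// expr2 lerDl.
by apply: sumr_ge0 => j _; rewrite -expr2 sqr_ge0.
Qed.

End dotv_algebra.

(** * Continuity, compactness and nearest points for the Euclidean norm *)

Section topology.
Context {R : realType}.

Lemma trmx_continuous k l : continuous (@trmx R k l).
Proof.
move=> M S /nbhs_ballP[e e0 es]; apply/nbhs_ballP; exists e => // N [_ MN].
by apply: es; split=> // i j; rewrite !mxE.
Qed.

Lemma interior_enorm k (S : set 'cV[R]_k) x : interior S x ->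
  exists2 e, 0 < e & forall y, enorm (y - x) <= e -> S y.
Proof.
move=> /nbhs_ballP[e /= e0 es]; exists (e / 2); first by rewrite divr_gt0.
move=> y yx; apply: es; split=> // i j; rewrite ord1 -ball_normE /ball_/=.
have := coord_le_enorm (y - x) i; rewrite !mxE distrC => h.
by rewrite (le_lt_trans h)// (le_lt_trans yx)// ltr_pdivrMr// ltr_pMr// ltr1n.
Qed.

Definition coord_cont (T : topologicalType) k (f : T -> 'cV[R]_k) :=
  forall i, continuous (fun t => f t i 0).

Lemma coord_cont_id k : coord_cont (@id 'cV[R]_k).
Proof. by move=> i; exact: coord_continuous. Qed.

Lemma coord_cont_cst (T : topologicalType) k (v : 'cV[R]_k) :
  coord_cont (fun _ : T => v).
Proof. by move=> i; exact: cst_continuous. Qed.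

Lemma coord_contB (T : topologicalType) k (f g : T -> 'cV[R]_k) :
  coord_cont f -> coord_cont g -> coord_cont (fun t => f t - g t).
Proof.
move=> cf cg i t.
rewrite (_ : (fun t => _) = (fun t => f t i 0 - g t i 0)); last first.
  by apply/funext => s; rewrite !mxE.
by apply: cvgB; [exact: cf|exact: cg].
Qed.

Lemma coord_cont_mulmx (T : topologicalType) k l (M : 'M[R]_(l, k))
    (f : T -> 'cV[R]_k) : coord_cont f -> coord_cont (fun t => M *m f t).
Proof.
move=> cf i t.
rewrite (_ : (fun t => _) = (fun t => \sum_j M i j * f t j 0)); last first.
  by apply/funext => s; rewrite !mxE.
apply: cvg_big => [|j _]; first exact: add_continuous.
by apply: cvgM; [exact: cvg_cst|exact: cf].
Qed.

Lemma coord_cont_usub (T : topologicalType) k l (f : T -> 'cV[R]_(k + l)) :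
  coord_cont f -> coord_cont (fun t => usubmx (f t)).
Proof.
move=> cf i t; rewrite (_ : (fun t => _) = (fun t => f t (lshift l i) 0)).
  by exact: cf.
by apply/funext => s; rewrite !mxE.
Qed.

Lemma coord_cont_dsub (T : topologicalType) k l (f : T -> 'cV[R]_(k + l)) :
  coord_cont f -> coord_cont (fun t => dsubmx (f t)).
Proof.
move=> cf i t; rewrite (_ : (fun t => _) = (fun t => f t (rshift k i) 0)).
  by exact: cf.
by apply/funext => s; rewrite !mxE.
Qed.

Lemma continuous_dotv (T : topologicalType) k (f g : T -> 'cV[R]_k) :
  coord_cont f -> coord_cont g -> continuous (fun t => dotv (f t) (g t)).
Proof.
move=> cf cg t.
rewrite (_ : (fun t => _) = (fun t => \sum_i f t i 0 * g t i 0)); last first.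
  by apply/funext => s; rewrite dotvE.
apply: cvg_big => [|i _]; first exact: add_continuous.
exact: cvgM (cf i t) (cg i t).
Qed.

Lemma continuous_enorm (T : topologicalType) k (f : T -> 'cV[R]_k) :
  coord_cont f -> continuous (fun t => enorm (f t)).
Proof.
move=> cf t; apply: (@continuous_comp _ _ _ (fun t => dotv (f t) (f t)) Num.sqrt).
  exact: continuous_dotv.
exact: sqrt_continuous.
Qed.

Lemma closed_preimage_coord (T : topologicalType) k (f : T -> 'cV[R]_k)
    (S : set 'cV[R]_k) : coord_cont f -> closed S -> closed [set t | S (f t)].
Proof.
move=> cf cS; apply: (closed_comp (f := f)) cS => t _ B /nbhs_ballP[e /= e0 es].
have : nbhs t [set s | forall i, ball (f t i 0) e (f s i 0)].
  apply: filter_forall => i; apply: cf.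
  exact: nbhsx_ballx.
apply: filterS => s h; apply: es; split=> // i j; rewrite ord1; exact: h.
Qed.

Lemma closed_le_cont (T : topologicalType) (f g : T -> R) :
  continuous f -> continuous g -> closed [set t | f t <= g t].
Proof.
move=> cf cg.
rewrite (_ : [set t | _] = (fun t => g t - f t) @^-1` [set x | 0 <= x]).
  apply: closed_comp; last exact: closed_ge.
  move=> t _; apply: cvgB; [exact: cg|exact: cf].
by apply/seteqP; split=> t /=; rewrite subr_ge0.
Qed.

(** Heine-Borel for row vectors is transported by transposition; entries are dominated by the
    Euclidean norm, so the bound passes to the max norm. *)
Lemma bounded_closed_compact_cV k (S : set 'cV[R]_k) B :
  closed S -> (forall v, S v -> enorm v <= B) -> compact S.
Proof.
move=> cS bS; have -> : S = trmx @` [set u : 'rV[R]_k | S u^T].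
  apply/seteqP; split=> [v Sv|_ [u Su <-]//].
  by exists v^T; rewrite /= trmxK.
apply: continuous_compact; first exact/continuous_subspaceT/trmx_continuous.
apply: bounded_closed_compact; last first.
  by apply: closed_comp cS => x _; exact: trmx_continuous.
exists B; split; first exact: num_real.
move=> M BM u /bS /= uB; rewrite [leLHS]/Num.Def.normr /= mx_normrE; apply/bigmax_leP.
split=> [|i _]; first by rewrite (le_trans _ (ltW BM))// (le_trans _ uB) ?enorm_ge0.
have := coord_le_enorm u^T i.2; rewrite mxE ord1 => h.
by rewrite (le_trans h)// (le_trans uB)// ltW.
Qed.

(** Points farther from [w] than a chosen [v0] cannot compete, so the minimum is taken over a
    compact part of [S]. *)
Lemma nearest_point k (S : set 'cV[R]_k) w : closed S -> S !=set0 ->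
  exists2 p, S p & forall v, S v -> enorm (w - p) <= enorm (w - v).
Proof.
move=> cS [v0 Sv0]; pose B := enorm (w - v0).
pose S' := S `&` [set v | enorm (w - v) <= B].
have cwv : coord_cont (fun v : 'cV[R]_k => w - v).
  by apply: coord_contB; [exact: coord_cont_cst|exact: coord_cont_id].
have cS' : compact S'.
  apply: (@bounded_closed_compact_cV _ _ (enorm w + B)).
    apply: closedI => //; apply: closed_le_cont; first exact: continuous_enorm.
    exact: cst_continuous.
  move=> v [_ /= vB]; rewrite -[v](subKr w) (le_trans (enormD _ _))//.
  by rewrite enormN lerD2l.
have [] := @compact_EVT_min _ R (fun v : 'cV[R]_k => enorm (w - v)) S' _ cS'.
- by exists v0; split => //=.
- exact/continuous_subspaceT/continuous_enorm.
move=> p /set_mem[Sp pB] hp; exists p => // v Sv.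
have [vB|/ltW Bv] := leP (enorm (w - v)) B; last exact: le_trans Bv.
by apply: hp; apply/mem_set; split.
Qed.

Lemma distE k (S : set 'cV[R]_k) w p : S p ->
  (forall v, S v -> enorm (w - p) <= enorm (w - v)) -> dist w S = enorm (w - p).
Proof.
move=> Sp hp; apply/eqP; rewrite eq_le; apply/andP; split.
  apply: ge_inf; last by exists p.
  by exists 0 => _ [v _ <-]; exact: enorm_ge0.
apply: lb_le_inf; first by exists (enorm (w - p)), p.
by move=> _ [v Sv <-]; exact: hp.
Qed.

Lemma dist_le k (S : set 'cV[R]_k) w v : S v -> dist w S <= enorm (w - v).
Proof.
move=> Sv; apply: ge_inf; last by exists v.
by exists 0 => _ [u _ <-]; exact: enorm_ge0.
Qed.

End topology.

(** * Pseudo-inverse and singular values *)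

Section pseudoinverse.
Context {R : realType}.

Lemma row_free_gram k l (F : 'M[R]_(k, l)) : row_free F -> F *m F^T \in unitmx.
Proof.
move=> Ff; rewrite -row_free_unit; apply: inj_row_free => v v0.
apply/eqP; rewrite -(mulmx_free_eq0 v Ff); apply/eqP.
apply: trmx_inj; rewrite trmx0; apply: dotv_eq0.
by rewrite /dotv trmxK trmx_mul -!mulmxA (mulmxA F) (mulmxA v) v0 mul0mx mxE.
Qed.

(** Full-rank factorization [M = C F]: both Gram matrices are invertible and the inverse is
    [F^T (F F^T)^-1 (C^T C)^-1 C^T]. *)
Lemma penrose_exists k l (M : 'M[R]_(k, l)) : exists X, penrose M X.
Proof.
have [r [C [F [MCF uF uC]]]] : exists r (C : 'M[R]_(k, r)) (F : 'M[R]_(r, l)),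
    [/\ M = C *m F, F *m F^T \in unitmx & C^T *m C \in unitmx].
  exists (\rank M), (col_base M), (row_base M); split.
  - by rewrite mulmx_base.
  - exact/row_free_gram/row_base_free.
  - rewrite -[X in _ *m X]trmxK; apply: row_free_gram.
    by have := col_base_full M; rewrite /row_full /row_free mxrank_tr.
pose X := F^T *m invmx (F *m F^T) *m invmx (C^T *m C) *m C^T.
have MX : M *m X = C *m invmx (C^T *m C) *m C^T.
  rewrite /X MCF !mulmxA -(mulmxA C F) -(mulmxA C (F *m F^T)) mulmxV//.
  by rewrite mulmx1.
have XM : X *m M = F^T *m invmx (F *m F^T) *m F.
  rewrite /X MCF -!mulmxA (mulmxA C^T) (mulmxA (invmx (C^T *m C))) mulVmx//.
  by rewrite mul1mx.
exists X; split.
- by rewrite MX MCF -!mulmxA (mulmxA C^T) (mulmxA (invmx _)) mulVmx// mul1mx.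
- rewrite XM /X -!mulmxA (mulmxA F F^T) (mulmxA (F *m F^T)) mulmxV//.
  by rewrite mul1mx.
- by rewrite MX !trmx_mul trmxK trmx_inv trmx_mul trmxK mulmxA.
- by rewrite XM !trmx_mul trmxK trmx_inv trmx_mul trmxK mulmxA.
Qed.

Lemma mp_inverseP k l (M : 'M[R]_(k, l)) : penrose M (mp_inverse M).
Proof. exact: (xgetPex 0 (penrose_exists M)). Qed.

(* The orthogonal projection onto the range of [M^T]. *)
Definition rowproj k l (M : 'M[R]_(k, l)) := mp_inverse M *m M.

Lemma mulmx_rowproj k l (M : 'M[R]_(k, l)) : M *m rowproj M = M.
Proof. by have [h _ _ _] := mp_inverseP M; rewrite mulmxA. Qed.

Lemma tr_rowproj k l (M : 'M[R]_(k, l)) : (rowproj M)^T = rowproj M.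
Proof. by have [_ _ _ h] := mp_inverseP M. Qed.

Lemma rowprojK k l (M : 'M[R]_(k, l)) : rowproj M *m rowproj M = rowproj M.
Proof. by rewrite {1}/rowproj -mulmxA mulmx_rowproj. Qed.

Lemma rowproj_tr k l (M : 'M[R]_(k, l)) : rowproj M *m M^T = M^T.
Proof. by rewrite -tr_rowproj -trmx_mul mulmx_rowproj. Qed.

Lemma tr_mulmx_mp k l (M : 'M[R]_(k, l)) : M^T *m (M *m mp_inverse M) = M^T.
Proof. by have [h _ <- _] := mp_inverseP M; rewrite -trmx_mul h. Qed.

(** [M] and [M M^T] have the same range: [b] is the Gram matrix applied to [(mp_inverse M)^T x0],
    and a matrix times its pseudo-inverse fixes its range. *)
Lemma mulmx_pseudo_solution k l (M : 'M[R]_(k, l)) (b : 'cV[R]_k) x0 :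
  M *m x0 = b -> M *m (M^T *m mp_inverse (M *m M^T) *m b) = b.
Proof.
move=> <-; set G := M *m M^T; have [h _ _ _] := mp_inverseP G.
have -> : M *m x0 = G *m ((mp_inverse M)^T *m x0).
  rewrite /G -mulmxA (mulmxA M^T) -trmx_mul -/(rowproj M) tr_rowproj.
  by rewrite mulmxA mulmx_rowproj.
by rewrite !mulmxA -/G -[_ *m M *m M^T]mulmxA -/G h.
Qed.

End pseudoinverse.

Section singular_values.
Context {R : realType} {k l : nat}.
Variable M : 'M[R]_(k, l).
Hypothesis M0 : M != 0.

Lemma exists_mulmx_neq0 : exists u : 'cV[R]_l, M *m u != 0.
Proof.
have [j Mj] : exists j, col j M != 0.
  apply/existsP; apply: contraR M0; rewrite negb_exists => /forallP h.
  by apply/eqP/matrixP => i j; have /negPn/eqP/colP/(_ i) := h j; rewrite !mxE.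
by exists (delta_mx j 0); rewrite -colE.
Qed.

Let onsphere (u : 'cV[R]_l) : u != 0 -> enorm ((enorm u)^-1 *: u) = 1.
Proof.
move=> u0; have e0 : enorm u != 0 by apply: contra u0 => /eqP/enorm_eq0/eqP.
by rewrite enormZ normfV ger0_norm ?enorm_ge0// mulVf.
Qed.

Let closed_sphere : closed [set u : 'cV[R]_l | enorm u = 1].
Proof.
rewrite (_ : mkset _ = [set u | enorm u <= 1] `&` [set u | 1 <= enorm u]).
  have c1 : continuous (fun u : 'cV[R]_l => enorm u).
    exact/continuous_enorm/coord_cont_id.
  by apply: closedI; apply: closed_le_cont => //; exact: cst_continuous.
apply/seteqP; split=> u /= => [->//|[h1 h2]].
by apply/eqP; rewrite eq_le h1.
Qed.

Let cont_M2 : continuous (fun u : 'cV[R]_l => dotv (M *m u) (M *m u)).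
Proof. by apply: continuous_dotv; exact/coord_cont_mulmx/coord_cont_id. Qed.

Let eigen_of (u : 'cV[R]_l) m : u != 0 -> M^T *m M *m u = m *: u ->
  eigenvalue (M^T *m M) m.
Proof.
move=> u0 h; apply/eigenvalueP; exists u^T; last by rewrite trmx_eq0.
by rewrite -[M^T *m M]trmxK -trmx_mul (trmx_mul M^T) trmxK h linearZ.
Qed.

(** [u] maximizes the Rayleigh quotient on the sphere; then [m - M^T M] is semidefinite and its form
    vanishes at [u], so [u] lies in its kernel. *)
Lemma singular_max : exists2 u : 'cV[R]_l, u != 0 /\ 0 < dotv (M *m u) (M *m u) &
  M^T *m M *m u = dotv (M *m u) (M *m u) *: u /\
  forall v : 'cV[R]_l, dotv (M *m v) (M *m v) <= dotv (M *m u) (M *m u) * dotv v v.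
Proof.
pose S := [set u : 'cV[R]_l | enorm u = 1].
have [u1 Mu1] := exists_mulmx_neq0.
have u10 : u1 != 0 by apply: contra Mu1 => /eqP ->; rewrite mulmx0.
have [] := @compact_EVT_max _ R (fun u : 'cV[R]_l => dotv (M *m u) (M *m u)) S.
- by exists ((enorm u1)^-1 *: u1); exact: onsphere.
- by apply: (@bounded_closed_compact_cV _ _ _ 1) => // v ->.
- exact/continuous_subspaceT.
move=> u /set_mem uS hu; pose m := dotv (M *m u) (M *m u).
have un : dotv u u = 1 by rewrite -sqr_enorm uS expr1n.
have u0 : u != 0.
  apply: contraPneq un => ->; rewrite dotv0l => /esym/eqP.
  by rewrite oner_eq0.
have hm v : dotv (M *m v) (M *m v) <= m * dotv v v.
  have [->|v0] := eqVneq v 0; first by rewrite mulmx0 !dotv0l mulr0.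
  have := hu _ (mem_set (onsphere v0)); rewrite -scalemxAr !dotv_lin -/m mulrA.
  rewrite -expr2 exprVn sqr_enorm => h; rewrite -ler_pdivrMr; last first.
    rewrite lt_def dotv_ge0 andbT; apply: contra v0 => /eqP; move/dotv_eq0 => ->.
    exact: eqxx.
  by rewrite mulrC.
have m0 : 0 < m.
  rewrite ltNge; apply/negP => m0; move/eqP: Mu1; apply; apply: dotv_eq0.
  apply/eqP; rewrite eq_le dotv_ge0 andbT (le_trans (hm _))//.
  by rewrite mulr_le0_ge0 ?dotv_ge0.
exists u; rewrite -/m //; split=> //.
pose Q := m%:M - M^T *m M.
have Qv v w : dotv v (Q *m w) = m * dotv v w - dotv (M *m v) (M *m w).
  by rewrite mulmxBl mul_scalar_mx !dotv_lin -mulmxA dotv_mulmxl.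
have pQ : psd Q.
  split=> [|v]; first by rewrite linearB/= tr_scalar_mx trmx_mul trmxK.
  by rewrite Qv subr_ge0.
have Qu : Q *m u = 0.
  apply: dotv_eq0; rewrite (psd_sym _ _ pQ) -dotvC.
  rewrite [RHS](_ : _ = dotv u (Q *m (Q *m u))); last first.
    by rewrite (psd_kernel _ pQ)// Qv un mulr1 subrr.
  by rewrite dotvC.
by move: Qu; rewrite mulmxBl mul_scalar_mx => /eqP; rewrite subr_eq0 => /eqP.
Qed.

(** The minimum over the whole sphere may be 0, so the sphere is cut by the row space; subtracting
    [m] times the row-space projection, rather than [m] times the identity, keeps the form
    semidefinite everywhere. *)
Lemma singular_min : exists2 u : 'cV[R]_l, u != 0 /\ 0 < dotv (M *m u) (M *m u) &
  M^T *m M *m u = dotv (M *m u) (M *m u) *: u /\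
  forall v : 'cV[R]_l, rowproj M *m v = v ->
    dotv (M *m u) (M *m u) * dotv v v <= dotv (M *m v) (M *m v).
Proof.
pose S := [set u : 'cV[R]_l | enorm u = 1 /\ rowproj M *m u = u].
have [u1 Mu1] := exists_mulmx_neq0.
have Pu1 : rowproj M *m u1 != 0.
  by apply: contra Mu1 => /eqP h; rewrite -(mulmx_rowproj M) -mulmxA h mulmx0.
have [] := @compact_EVT_min _ R (fun u : 'cV[R]_l => dotv (M *m u) (M *m u)) S.
- exists ((enorm (rowproj M *m u1))^-1 *: (rowproj M *m u1)); split.
    exact: onsphere.
  by rewrite -scalemxAr mulmxA rowprojK.
- apply: (@bounded_closed_compact_cV _ _ _ 1) => [|v [->//]].
  suff cP : closed [set u : 'cV[R]_l | rowproj M *m u = u] by apply: closedI.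
  have -> : [set u : 'cV[R]_l | rowproj M *m u = u] =
      [set u | [set 0] (rowproj M *m u - u)].
    apply/seteqP; split=> u /= => [->|/eqP]; first by rewrite subrr.
    by rewrite subr_eq0 => /eqP.
  apply: closed_preimage_coord.
    by apply: coord_contB; [exact/coord_cont_mulmx/coord_cont_id|exact: coord_cont_id].
  have -> : [set (0 : 'cV[R]_l)] = [set u | enorm u <= 0].
    apply/seteqP; split=> [_ ->|u /= h] /=; first by rewrite enorm0.
    by apply: enorm_eq0; apply/eqP; rewrite eq_le h enorm_ge0.
  apply: closed_le_cont; last exact: cst_continuous.
  exact/continuous_enorm/coord_cont_id.
- exact/continuous_subspaceT.
move=> u /set_mem[uS Pu] hu; pose m := dotv (M *m u) (M *m u).
have un : dotv u u = 1 by rewrite -sqr_enorm uS expr1n.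
have u0 : u != 0.
  apply: contraPneq un => ->; rewrite dotv0l => /esym/eqP.
  by rewrite oner_eq0.
have hm v : rowproj M *m v = v -> m * dotv v v <= dotv (M *m v) (M *m v).
  move=> Pv; have [->|v0] := eqVneq v 0; first by rewrite mulmx0 !dotv0l mulr0.
  have := hu ((enorm v)^-1 *: v); rewrite inE /S/= -scalemxAr Pv onsphere//.
  move=> /(_ (conj erefl erefl)).
  rewrite -scalemxAr !dotv_lin -/m mulrA.
  rewrite -expr2 exprVn sqr_enorm => h; rewrite -ler_pdivlMr; last first.
    rewrite lt_def dotv_ge0 andbT; apply: contra v0 => /eqP; move/dotv_eq0 => ->.
    exact: eqxx.
  by rewrite mulrC.
have m0 : 0 < m.
  rewrite lt_def dotv_ge0 andbT; apply: contra u0 => /eqP/dotv_eq0 h.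
  by rewrite -Pu /rowproj -mulmxA h mulmx0.
exists u; rewrite -/m //; split=> //.
pose Q := M^T *m M - m *: rowproj M.
have Qv v w : dotv v (Q *m w) = dotv (M *m v) (M *m w) - m * dotv v (rowproj M *m w).
  by rewrite mulmxBl -scalemxAl !dotv_lin -mulmxA dotv_mulmxl.
have pQ : psd Q.
  split=> [|v].
    by rewrite linearB/= linearZ/= trmx_mul trmxK tr_rowproj.
  rewrite Qv subr_ge0.
  have -> : dotv v (rowproj M *m v) = dotv (rowproj M *m v) (rowproj M *m v).
    by rewrite -{1}rowprojK -mulmxA dotv_mulmxr tr_rowproj.
  have -> : M *m v = M *m (rowproj M *m v) by rewrite mulmxA mulmx_rowproj.
  by rewrite hm// mulmxA rowprojK.
have Qu : Q *m u = 0.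
  apply: dotv_eq0; rewrite (psd_sym _ _ pQ).
  by rewrite (psd_kernel _ pQ)// Qv Pu un mulr1 subrr.
move: Qu; rewrite mulmxBl -scalemxAl Pu => /eqP.
by rewrite subr_eq0 => /eqP.
Qed.

(** An eigenvector with positive eigenvalue lies in Im(M^T), hence is fixed by the row-space
    projection; this admits it as a test vector for [singular_min]. *)
Lemma pos_singularE a : pos_singular_values M a -> 0 < a /\
  exists v : 'cV[R]_l, [/\ v != 0, rowproj M *m v = v &
    dotv (M *m v) (M *m v) = a ^+ 2 * dotv v v].
Proof.
move=> [a0 /eigenvalueP[v hv v0]]; split=> //; exists v^T.
have h : M^T *m (M *m v^T) = a ^+ 2 *: v^T.
  apply: trmx_inj; rewrite mulmxA trmx_mul trmxK (trmx_mul M^T) trmxK hv.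
  by rewrite linearZ/= trmxK.
split; first by rewrite trmx_eq0.
  have -> : v^T = (a ^+ 2)^-1 *: (M^T *m (M *m v^T)).
    by rewrite h scalerA mulVf ?scale1r// expf_neq0// gt_eqF.
  by rewrite -scalemxAr (mulmxA (rowproj M)) rowproj_tr.
by rewrite dotv_mulmxl h dotv_lin.
Qed.

Lemma lambda_maxP : [/\ pos_singular_values M (lambda_max M),
  (forall u : 'cV[R]_l, enorm (M *m u) <= lambda_max M * enorm u) &
  0 < lambda_max M].
Proof.
have [u [u0 m0] [eu hu]] := singular_max.
pose a := enorm (M *m u).
have a2 : a ^+ 2 = dotv (M *m u) (M *m u) by rewrite sqr_enorm.
have a0 : 0 < a by rewrite lt_def enorm_ge0 andbT -sqrf_eq0 a2 gt_eqF.
have aS : pos_singular_values M a.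
  by split=> //; apply: (eigen_of u0); rewrite a2.
have ub x : pos_singular_values M x -> x <= a.
  move=> /pos_singularE[x0 [v [v0 _ hv]]].
  have vv : 0 < dotv v v.
    by rewrite lt_def dotv_ge0 andbT; apply: contra v0 => /eqP/dotv_eq0 ->.
  rewrite -(@ler_pXn2r _ 2) ?nnegrE ?(ltW x0) ?(ltW a0)// a2.
  by have := hu v; rewrite hv ler_pM2r.
have -> : lambda_max M = a.
  apply/eqP; rewrite eq_le; apply/andP; split.
    by apply: sup_le_ub; first by exists a.
  by apply: ub_le_sup => //; exists a.
split=> // v; rewrite -(@ler_pXn2r _ 2) ?nnegrE ?mulr_ge0 ?enorm_ge0 ?(ltW a0)//.
by rewrite exprMn a2 !sqr_enorm.
Qed.

Lemma lambda_minP : [/\ pos_singular_values M (lambda_min M),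
  (forall u : 'cV[R]_l, rowproj M *m u = u ->
     lambda_min M * enorm u <= enorm (M *m u)) &
  0 < lambda_min M].
Proof.
have [u [u0 m0] [eu hu]] := singular_min.
pose a := enorm (M *m u).
have a2 : a ^+ 2 = dotv (M *m u) (M *m u) by rewrite sqr_enorm.
have a0 : 0 < a by rewrite lt_def enorm_ge0 andbT -sqrf_eq0 a2 gt_eqF.
have aS : pos_singular_values M a.
  by split=> //; apply: (eigen_of u0); rewrite a2.
have lb x : pos_singular_values M x -> a <= x.
  move=> /pos_singularE[x0 [v [v0 Pv hv]]].
  have vv : 0 < dotv v v.
    by rewrite lt_def dotv_ge0 andbT; apply: contra v0 => /eqP/dotv_eq0 ->.
  rewrite -(@ler_pXn2r _ 2) ?nnegrE ?(ltW x0) ?(ltW a0)// a2.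
  by have := hu v Pv; rewrite hv ler_pM2r.
have -> : lambda_min M = a.
  apply/eqP; rewrite eq_le; apply/andP; split.
    by apply: ge_inf => //; exists a.
  by apply: lb_le_inf => //; exists a.
split=> // v Pv; rewrite -(@ler_pXn2r _ 2) ?nnegrE ?mulr_ge0 ?enorm_ge0 ?(ltW a0)//.
by rewrite exprMn a2 !sqr_enorm; exact: hu.
Qed.

Lemma kappa_ge1 : 1 <= kappa M.
Proof.
have [/pos_singularE[L0 [v [v0 Pv hv]]] _ _] := lambda_maxP.
have [_ h l0] := lambda_minP.
rewrite /kappa ler_pdivlMr// mul1r.
have vv : 0 < enorm v.
  by rewrite lt_def enorm_ge0 andbT; apply: contra v0 => /eqP/enorm_eq0 ->.
have := h _ Pv; rewrite -(@ler_pXn2r _ 2) ?nnegrE ?mulr_ge0 ?enorm_ge0 ?(ltW l0)//.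
rewrite sqr_enorm hv -sqr_enorm exprMn ler_pM2r ?exprn_gt0//.
by rewrite ler_pXn2r// nnegrE ?(ltW l0) ?(ltW L0).
Qed.

Lemma enorm_tr_le (y : 'cV[R]_k) : enorm (M^T *m y) <= lambda_max M * enorm y.
Proof.
have [_ h L0] := lambda_maxP.
have [->|n0] := eqVneq (enorm (M^T *m y)) 0.
  by rewrite mulr_ge0 ?enorm_ge0// ltW.
rewrite -(@ler_pM2l _ (enorm (M^T *m y))); last by rewrite lt_def n0 enorm_ge0.
rewrite -expr2 sqr_enorm dotv_mulmxl trmxK (le_trans (dotv_CS _ _))//.
by have := h (M^T *m y); have := enorm_ge0 y; nra.
Qed.

(** With [y = M u] and [u] in the row space, [|y|^2 = u . M^T y <= |u| |M^T y|] while
    [lambda_min |u| <= |y|]; the spectrum of [M M^T] never enters. *)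
Lemma enorm_tr_ge (y : 'cV[R]_k) : (exists v : 'cV[R]_l, y = M *m v) ->
  lambda_min M * enorm y <= enorm (M^T *m y).
Proof.
move=> [v ->] {y}; have [_ h l0] := lambda_minP.
rewrite -(mulmx_rowproj M) -[_ *m v]mulmxA; set u := rowproj M *m v.
have Pu : rowproj M *m u = u by rewrite mulmxA rowprojK.
rewrite mulmx_rowproj; set y := M *m u.
have [->|n0] := eqVneq (enorm y) 0; first by rewrite mulr0 enorm_ge0.
have y0 : 0 < enorm y by rewrite lt_def n0 enorm_ge0.
rewrite -(@ler_pM2r _ (enorm y))// -mulrA -expr2 sqr_enorm {1}/y dotv_mulmxl.
rewrite (le_trans (ler_wpM2l (ltW l0) (dotv_CS _ _)))//.
by have := h _ Pu; have := enorm_ge0 (M^T *m y); rewrite -/y; nra.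
Qed.

End singular_values.

(** * Cones and PDHG *)

Section cones.
Context {R : realType} {k : nat}.
Variable S : set 'cV[R]_k.
Hypothesis (S_closed : closed S) (S_cone : convex_cone S) (S_ne : S !=set0).

Lemma coneZ a x : 0 <= a -> S x -> S (a *: x).
Proof. by case: S_cone => _; apply. Qed.

Lemma coneD x y : S x -> S y -> S (x + y).
Proof.
have [cS zS] := S_cone; move=> Sx Sy.
have h0 : 0 <= (2^-1 : R) by rewrite invr_ge0.
have h1 : (2^-1 : R) <= 1 by rewrite invf_le1// ler1n.
have h := zS 2 _ (ler0n _ _)
  (set_mem (cS x y (Itv01 h0 h1) (mem_set Sx) (mem_set Sy))).
suff -> : x + y = 2 *: (conv (Itv01 h0 h1) (x : convex_lmodType _) y : 'cV[R]_k).
  by [].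
rewrite -[RHS]/(2 *: (2^-1 *: x + (1 - 2^-1) *: y)) scalerDr !scalerA.
by have -> : 2 * (1 - 2^-1) = 1 :> R; [field|rewrite mulfV ?scale1r].
Qed.

Lemma cone0 : S 0.
Proof. by have [x Sx] := S_ne; rewrite -(scale0r x); apply: coneZ. Qed.

Lemma cone_conv t x y : 0 <= t <= 1 -> S x -> S y -> S (x + t *: (y - x)).
Proof.
move=> /andP[t0 t1] Sx Sy.
have -> : x + t *: (y - x) = (1 - t) *: x + t *: y.
  by rewrite scalerBr scalerBl scale1r addrA addrAC.
by apply: coneD; apply: coneZ => //; rewrite subr_ge0.
Qed.

Lemma eprojP w : S (eproj S w) /\
  forall v, S v -> enorm (w - eproj S w) <= enorm (w - v).
Proof.
have [p Sp hp] := nearest_point w S_closed S_ne.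
by have := xgetPex 0 (ex_intro _ p (conj Sp hp) :
  exists p, S p /\ forall v, S v -> enorm (w - p) <= enorm (w - v)).
Qed.

Lemma eproj_in w : S (eproj S w).
Proof. by case: (eprojP w). Qed.

Lemma eproj_var w v : S v -> dotv (w - eproj S w) (v - eproj S w) <= 0.
Proof.
move=> Sv; have [Sp hp] := eprojP w; set p := eproj S w in Sp hp *.
rewrite leNgt; apply/negP => d0; set d := dotv _ _ in d0.
have e t : 0 <= t <= 1 -> 2 * t * d <= t ^+ 2 * dotv (v - p) (v - p).
  move=> t01; have := hp _ (cone_conv t01 Sp Sv).
  rewrite enorm_le.
  have -> : w - (p + t *: (v - p)) = (w - p) - t *: (v - p).
    by rewrite opprD addrA.
  have := erefl d; rewrite {1}/d; move: (w - p) (v - p) => a g ag.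
  rewrite !dotv_lin (dotvC g a) ag; lra.
have D0 : 0 < dotv (v - p) (v - p) + d.
  by rewrite ltr_wpDl ?dotv_ge0.
(* The step [s = d / (D + d)] lies in [0, 1] even when [D = 0]; it would give [2 d <= s D], whereas
   [s D < d]. *)
have := e (d / (dotv (v - p) (v - p) + d)).
rewrite divr_ge0 ?(ltW d0) ?(ltW D0)//= ler_pdivrMr// mul1r lerDr dotv_ge0.
move=> /(_ isT); set D := dotv (v - p) _ in D0 *; set s := d / _.
have s0 : 0 < s by rewrite divr_gt0.
have -> : 2 * s * d = s * (2 * d) by ring.
rewrite expr2 -mulrA ler_pM2l// => h.
have sD : s * D < d.
  by rewrite /s mulrAC ltr_pdivrMr// ltr_pM2l// ltrDl.
lra.
Qed.

Lemma eproj_orth w : dotv (w - eproj S w) (eproj S w) = 0.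
Proof.
have := eproj_var w cone0; have h := coneZ (ler0n _ 2) (eproj_in w).
have := eproj_var w h; rewrite !dotv_lin; lra.
Qed.

Lemma eproj_polar w v : S v -> dotv (w - eproj S w) v <= 0.
Proof.
move=> /(eproj_var w); have := eproj_orth w; rewrite dotvDr dotvNr; lra.
Qed.

Lemma dual_coneD s t : dual_cone S s -> dual_cone S t -> dual_cone S (s + t).
Proof. by move=> hs ht x Sx; rewrite dotvDr addr_ge0 ?hs ?ht. Qed.

Lemma dual_coneZ a s : 0 <= a -> dual_cone S s -> dual_cone S (a *: s).
Proof. by move=> a0 hs x Sx; rewrite dotvZr mulr_ge0 ?hs. Qed.

(* Moreau: [- s] is its projection on the cone plus a polar vector. *)
Lemma dual_cone_proj s : dual_cone S (s + eproj S (- s)).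
Proof.
move=> x /(eproj_polar (- s)); rewrite -opprD dotvNl dotvC; lra.
Qed.

End cones.

(** * PDHG steps, averages and the normalized duality gap *)

Section pdhg.
Context {R : realType} {m n : nat}.
Variables (A : 'M[R]_(m, n)) (b : 'cV[R]_m) (c : 'cV[R]_n) (Kp : set 'cV[R]_n).
Variables (tau sigma : R).
Hypothesis (Kp_closed : closed Kp) (Kp_cone : convex_cone Kp).
Hypothesis (Kp_ne : Kp !=set0).
Hypothesis (tau0 : 0 < tau) (sigma0 : 0 < sigma).

Notation M := (Mmx A tau sigma).
Notation step := (onePDHG A b c Kp tau sigma).
Notation avg := (average A b c Kp tau sigma).
Notation nM := (normM A tau sigma).

Definition gapL (z zh : 'cV[R]_(n + m)) : R :=
  Lagr A b c (usubmx z) (dsubmx zh) - Lagr A b c (usubmx zh) (dsubmx z).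

Definition saddle (z : 'cV[R]_(n + m)) := Kp (usubmx z) /\
  forall zh, Kp (usubmx zh) -> gapL z zh <= 0.

Lemma gapLE z zh : gapL z zh =
  dotv (b - A *m usubmx z) (dsubmx zh - dsubmx z) -
  dotv (c - A^T *m dsubmx z) (usubmx zh - usubmx z).
Proof.
rewrite /gapL /Lagr !dotv_lin !(dotv_mulmxl A) !(dotvC (A^T *m _)); ring.
Qed.

(** No term pairs the two halves of [z] with each other, so for a fixed comparison point the gap of
    an average is exactly the average of the gaps. *)
Lemma gapL_lin z zh : gapL z zh =
  dotv (col_mx (c - A^T *m dsubmx zh) (A *m usubmx zh - b)) z +
  (dotv b (dsubmx zh) - dotv c (usubmx zh)).
Proof.
rewrite -[in dotv _ z](vsubmxK z) dotv_col_mx /gapL /Lagr !dotv_lin.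
rewrite (dotvC (A^T *m _) (usubmx z)) (dotv_mulmxl A (usubmx zh)); ring.
Qed.

Lemma usub_segment (z zh : 'cV[R]_(n + m)) t :
  usubmx (z + t *: (zh - z)) = usubmx z + t *: (usubmx zh - usubmx z).
Proof. by rewrite linearD linearZ linearB. Qed.

Lemma dsub_segment (z zh : 'cV[R]_(n + m)) t :
  dsubmx (z + t *: (zh - z)) = dsubmx z + t *: (dsubmx zh - dsubmx z).
Proof. by rewrite linearD linearZ linearB. Qed.

Lemma gapL_segment z zh t : gapL z (z + t *: (zh - z)) = t * gapL z zh.
Proof.
rewrite !gapLE usub_segment dsub_segment.
by rewrite !(addrAC _ (t *: _)) !subrr !add0r !dotvZr mulrBr.
Qed.

Lemma gapLN z zh : gapL z zh = - gapL zh z.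
Proof. rewrite /gapL; ring. Qed.

Lemma MmxE x y x' y' : dotv (col_mx x y) (M *m col_mx x' y') =
  tau^-1 * dotv x x' + dotv x (A^T *m y') + dotv y (A *m x') +
  sigma^-1 * dotv y y'.
Proof.
rewrite /Mmx mul_block_col dotv_col_mx !mul_scalar_mx !dotv_lin; ring.
Qed.

(** The primal half is the variational inequality of the projection, the dual half an identity; the
    extrapolation [2 x' - x] leaves exactly the off-diagonal blocks of [M]. *)
Lemma pdhg_step z zh : Kp (usubmx zh) ->
  gapL (step z) zh <= dotv (zh - step z) (M *m (step z - z)).
Proof.
move=> Kzh.
have hvar := eproj_var Kp_closed Kp_cone Kp_ne
  (usubmx z - tau *: (c - A^T *m dsubmx z)) Kzh.
set z' := step z; set x' := eproj _ _ in hvar.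
have zu : usubmx z' = x' by rewrite col_mxKu.
have zd : dsubmx z' = dsubmx z + sigma *: (b - A *m (2 *: x' - usubmx z)).
  by rewrite col_mxKd.
clearbody z' x'.
rewrite -(vsubmxK zh) -(vsubmxK z) -(vsubmxK z') !opp_col_mx !add_col_mx MmxE.
rewrite gapLE !col_mxKu !col_mxKd zu zd.
move: hvar; set xh := usubmx zh; set yh := dsubmx zh; set x := usubmx z.
set y := dsubmx z.
set r := b - A *m (2 *: x' - x); set u := xh - x'; set v := yh - _.
have -> : y + sigma *: r - y = sigma *: r by rewrite addrC addKr.
have -> : b - A *m x' = r + A *m (x' - x).
  rewrite /r !mulmxBr -scalemxAr scaler_nat mulr2n.
  by move: (A *m x') (A *m x) => p q; apply/colP => i; rewrite !mxE; ring.
clearbody u v r.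
rewrite !mulmxDr !mulmxN -!scalemxAr !dotv_lin !(dotvC _ u) !(dotvC _ v) => h.
have {}h : dotv u x - dotv u x' <= tau * (dotv u c - dotv u (A^T *m y)).
  by move: h; lra.
have {}h : tau^-1 * (dotv u x - dotv u x') <= dotv u c - dotv u (A^T *m y).
  by rewrite mulrC ler_pdivrMr// mulrC.
have -> : sigma^-1 * (sigma * dotv v r) = dotv v r by rewrite mulKf// gt_eqF.
lra.
Qed.

Hypothesis psdM : psd M.

Lemma normM_ge0 z : 0 <= nM z. Proof. exact: sqrtr_ge0. Qed.

Lemma normMN z : nM (- z) = nM z.
Proof. by rewrite -scaleN1r [LHS]seminormZ// normrN1 mul1r. Qed.

Lemma normMB z z' : nM (z - z') = nM (z' - z).
Proof. by rewrite -normMN opprB. Qed.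

Lemma normM_triangle z z' z'' : nM (z - z'') <= nM (z - z') + nM (z' - z'').
Proof. by rewrite (le_trans _ (seminormD _ _ psdM))// addrA subrK. Qed.

Lemma pdhg_descent z zh : Kp (usubmx zh) ->
  2 * gapL (step z) zh <= nM (z - zh) ^+ 2 - nM (step z - zh) ^+ 2.
Proof.
move=> /(pdhg_step z) h.
have [_ p0] := psdM; have := p0 (step z - z).
rewrite (normMB z) (normMB (step z)).
have -> : zh - z = zh - step z + 1 *: (step z - z) by rewrite scale1r addrA subrK.
rewrite /normM !sqr_sqrtr// psd_expand//; lra.
Qed.

Lemma usub_step z : Kp (usubmx (step z)).
Proof. by rewrite col_mxKu; apply: eproj_in. Qed.

Lemma pdhg_sum z0 zh k : Kp (usubmx zh) ->
  2 * \sum_(1 <= i < k.+1) gapL (iter i step z0) zh <=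
  nM (z0 - zh) ^+ 2 - nM (iter k step z0 - zh) ^+ 2.
Proof.
move=> Kzh; elim: k => [|k ih]; first by rewrite big_geq// mulr0 subrr.
rewrite big_nat_recr//= mulrDr.
have := pdhg_descent (iter k step z0) Kzh; lra.
Qed.

Lemma gapL_avg z0 zh k : (0 < k)%N ->
  \sum_(1 <= i < k.+1) gapL (iter i step z0) zh = k%:R * gapL (avg z0 k) zh.
Proof.
move=> k0; rewrite gapL_lin /average dotvZr mulrDr mulrA divff ?pnatr_eq0 -?lt0n//.
rewrite mul1r; under eq_bigr do rewrite gapL_lin.
rewrite big_split/= big_const_nat iter_addr_0 subn1/= mulr_natl; congr (_ + _).
elim/big_ind2: _ => [|x1 x2 y1 y2 -> ->|//]; first by rewrite dotv0r.
by rewrite dotvDr.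
Qed.

Lemma avg_gap z0 zh k : (0 < k)%N -> Kp (usubmx zh) ->
  gapL (avg z0 k) zh <= nM (z0 - zh) ^+ 2 / (2 * k%:R).
Proof.
move=> k0 Kzh; rewrite ler_pdivlMr ?mulr_gt0 ?ltr0n// mulrC -mulrA -gapL_avg//.
by rewrite (le_trans (pdhg_sum _ _ Kzh))// gerBl sqr_ge0.
Qed.

Lemma usub_avg z0 k : (0 < k)%N -> Kp (usubmx (avg z0 k)).
Proof.
move=> k0; rewrite /average linearZ/= linear_sum/=.
apply: coneZ => //.
rewrite big_nat; elim/big_ind: _ => [||i /andP[]]; first exact: cone0.
  by move=> *; apply: coneD.
by case: i => // i _ _; exact: usub_step.
Qed.

(** Preserved by PDHG because [b] is in the range of [A]; on this subspace [A^T y] controls [y]. *)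
Definition dual_range (z : 'cV[R]_(n + m)) := exists v : 'cV[R]_n, dsubmx z = A *m v.

Hypothesis b_range : exists x0, A *m x0 = b.

Lemma dual_range_step z : dual_range z -> dual_range (step z).
Proof.
move=> [v zv]; have [x0 bx0] := b_range.
set x' := eproj Kp (usubmx z - tau *: (c - A^T *m dsubmx z)).
exists (v + sigma *: (x0 - (2 *: x' - usubmx z))).
have -> : dsubmx (step z) =
  dsubmx z + sigma *: (b - A *m (2 *: x' - usubmx z)) by rewrite col_mxKd.
by rewrite zv (mulmxDr A v) -(scalemxAr sigma A) (mulmxBr A x0) bx0.
Qed.

Lemma dual_range_iter z i : dual_range z -> dual_range (iter i step z).
Proof. by move=> h; elim: i => // i ih; exact: dual_range_step. Qed.

Lemma dual_range_avg z k : dual_range z -> dual_range (avg z k).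
Proof.
move=> h; rewrite /dual_range /average linearZ/= linear_sum/=.
have [v ->] : exists v, \sum_(1 <= i < k.+1) dsubmx (iter i step z) = A *m v.
  elim/big_ind: _ => [|x y [v ->] [w ->]|i _].
  - by exists 0; rewrite mulmx0.
  - by exists (v + w); rewrite mulmxDr.
  - by have [v ->] := dual_range_iter i h; exists v.
by exists (k%:R^-1 *: v); rewrite scalemxAr.
Qed.

Lemma saddle_ge0 zs z : saddle zs -> Kp (usubmx z) -> 0 <= gapL z zs.
Proof. by move=> [_ h] Kz; rewrite gapLN oppr_ge0 h. Qed.

Lemma pdhg_fejer zs z i : saddle zs ->
  nM (iter i step z - zs) <= nM (z - zs).
Proof.
move=> zsP; elim: i => // i; apply: le_trans => /=.
rewrite -(@ler_pXn2r _ 2) ?nnegrE ?seminorm_ge0// -subr_ge0.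
apply: le_trans (pdhg_descent _ (proj1 zsP)).
by rewrite mulr_ge0// saddle_ge0//; exact: usub_step.
Qed.

Lemma avg_fejer zs z k : (0 < k)%N -> saddle zs -> nM (avg z k - zs) <= nM (z - zs).
Proof.
move=> k0 zsP; have kn0 : k%:R != 0 :> R by rewrite pnatr_eq0 -lt0n.
have -> : avg z k - zs = k%:R^-1 *: \sum_(1 <= i < k.+1) (iter i step z - zs).
  rewrite sumrB scalerBr; congr (_ - _).
  rewrite big_const_nat iter_addr_0 subn1/= -(scaler_nat k zs).
  by rewrite scalerA mulVf// scale1r.
rewrite [leLHS]seminormZ// ger0_norm ?invr_ge0// mulrC ler_pdivrMr ?ltr0n//.
have -> : nM (z - zs) * k%:R = \sum_(1 <= i < k.+1) nM (z - zs).
  by rewrite big_const_nat iter_addr_0 subn1/= mulr_natr.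
elim/big_ind2: _ => [|x1 x2 y1 y2 h1 h2|i _].
- by rewrite /seminorm mulmx0 dotv0l sqrtr0.
- by rewrite (le_trans (seminormD _ _ psdM))// lerD.
- exact: pdhg_fejer.
Qed.

(* [normM] is only a seminorm, since tau * sigma * lambda_max^2 = 1; a vanishing
   radius is therefore handled by optimality rather than by [avg z k = z]. *)
Lemma avg_saddle z k : (0 < k)%N -> nM (avg z k - z) = 0 -> saddle (avg z k).
Proof.
move=> k0 r0; have Kza := usub_avg z k0.
set za := avg z k in Kza *; split=> //.
move=> zh Kzh; rewrite leNgt; apply/negP => g0.
set g := gapL _ _ in g0; pose N := nM (zh - za) ^+ 2 / (2 * k%:R).
have N0 : 0 <= N by rewrite divr_ge0 ?sqr_ge0// mulr_ge0.
(* The gap is linear along the segment, but its bound is quadratic: the start is at zero M-distance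
   from the average, so its M-distance to the moved point is at most [t] times that from the average
   to [zh]. *)
have h t : 0 <= t <= 1 -> t * g <= t ^+ 2 * N.
  move=> t01; rewrite -gapL_segment.
  have Kt : Kp (usubmx (za + t *: (zh - za))).
    by rewrite usub_segment; exact: (cone_conv Kp_cone).
  rewrite (le_trans (avg_gap _ k0 Kt))// /N mulrA ler_pM2r; last first.
    by rewrite invr_gt0 mulr_gt0// ltr0n.
  have t0 : 0 <= t by case/andP: t01.
  rewrite -exprMn ler_pXn2r ?nnegrE ?(mulr_ge0 t0) ?normM_ge0//.
  rewrite (le_trans (normM_triangle _ za _))// normMB r0 add0r opprD addrA subrr sub0r.
  by rewrite normMN [leLHS]seminormZ// ger0_norm//; case/andP: t01.
have D0 : 0 < N + g by rewrite ltr_wpDl.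
have := h (g / (N + g)).
rewrite divr_ge0 ?(ltW g0) ?(ltW D0)//= ler_pdivrMr// mul1r lerDr N0.
move=> /(_ isT); set s := g / _; have s0 : 0 < s by rewrite divr_gt0.
rewrite expr2 -mulrA ler_pM2l// leNgt => /negP; apply.
by rewrite /s mulrAC ltr_pdivrMr// ltr_pM2l// ltrDl.
Qed.

Lemma rho_le r z q : 0 < r ->
  (forall zh, Kp (usubmx zh) -> nM (zh - z) <= r -> gapL z zh <= q * r) ->
  (rho A b c Kp tau sigma r z <= q%:E)%E.
Proof.
move=> r0 h; rewrite /rho muleC lee_pdivrMr//.
apply: ge_ereal_sup => _ [zh /= [Kzh hr] <-]; rewrite -EFinM lee_fin.
exact: h.
Qed.

Lemma rho_bound r z q zh : 0 < r -> (rho A b c Kp tau sigma r z <= q%:E)%E ->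
  Kp (usubmx zh) -> nM (zh - z) <= r -> gapL z zh <= q * r.
Proof.
move=> r0; rewrite /rho muleC lee_pdivrMr// => h Kzh hr.
rewrite -lee_fin EFinM; apply: le_trans h.
by apply: ereal_sup_ubound; exists zh.
Qed.

Lemma rho_ge0 r z : 0 < r -> Kp (usubmx z) ->
  (0 <= rho A b c Kp tau sigma r z)%E.
Proof.
move=> r0 Kz; apply: mule_ge0; first by rewrite lee_fin invr_ge0 ltW.
apply: ereal_sup_ubound; exists z; last by rewrite subrr.
split=> //; rewrite subrr /normM mulmx0 dotv0l sqrtr0 ltW//.
Qed.

(** A test point within [r] of the average is within [2 r] of the start, so its gap is at most
    [(2 r)^2 / (2 k)]; dividing by the radius leaves [2 r / k]. *)
Lemma rho_avg z k : (0 < k)%N -> 0 < nM (avg z k - z) ->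
  (rho A b c Kp tau sigma (nM (avg z k - z)) (avg z k) <=
   (2 * nM (avg z k - z) / k%:R)%:E)%E.
Proof.
move=> k0 r0; apply: rho_le => // zh Kzh; set r := nM (avg z k - z) => hr.
rewrite (le_trans (avg_gap _ k0 Kzh))//.
have -> : 2 * r / k%:R * r = (2 * r) ^+ 2 / (2 * k%:R).
  by field; rewrite pnatr_eq0 -lt0n.
rewrite ler_pM2r ?invr_gt0 ?mulr_gt0 ?ltr0n//.
rewrite ler_pXn2r// ?nnegrE ?normM_ge0 ?mulr_ge0 ?normM_ge0//.
rewrite (le_trans (normM_triangle _ (avg z k) _))// normMB (normMB _ zh) -/r; lra.
Qed.

End pdhg.

(** * Residuals and the normalized duality gap *)

Section residuals.
Context {R : realType} {m n : nat}.
Variables (A : 'M[R]_(m, n)) (b : 'cV[R]_m) (c : 'cV[R]_n) (Kp : set 'cV[R]_n).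
Hypothesis A_neq0 : A != 0.
Hypothesis (Kp_closed : closed Kp) (Kp_cone : convex_cone Kp).
Hypothesis (Kp_ne : Kp !=set0).
Hypothesis c_null : A *m c = 0.
Hypothesis b_range : exists x0, A *m x0 = b.

Notation kap := (kappa A).
Notation L := (lambda_max A).
Notation l := (lambda_min A).
Notation tau := (1 / kappa A).
Notation sigma := (1 / (lambda_max A * lambda_min A)).
Notation M := (Mmx A tau sigma).
Notation nM := (normM A tau sigma).
Notation q := (Num.sqrt (kappa A)).
Notation W := (slack_point A c).
Notation gapL := (gapL A b c).

Lemma lambda_max_gt0 : 0 < L. Proof. by have [] := lambda_maxP A_neq0. Qed.

Lemma lambda_min_gt0 : 0 < l. Proof. by have [] := lambda_minP A_neq0. Qed.

Lemma kappa_gt0 : 0 < kap.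
Proof. by rewrite divr_gt0 ?lambda_max_gt0 ?lambda_min_gt0. Qed.

Lemma sqr_sqrt_kappa : q ^+ 2 = kap.
Proof. by rewrite sqr_sqrtr// ltW// kappa_gt0. Qed.

Lemma sqrt_kappa_ge1 : 1 <= q.
Proof. by rewrite -sqrtr1 ler_sqrt ?(ltW kappa_gt0)// kappa_ge1. Qed.

Lemma sqrt_kappa_gt0 : 0 < q.
Proof. exact: lt_le_trans ltr01 sqrt_kappa_ge1. Qed.

Lemma tauV : tau^-1 = kap. Proof. by rewrite div1r invrK. Qed.

Lemma sigmaV : sigma^-1 = (q * l) ^+ 2.
Proof.
rewrite div1r invrK exprMn sqr_sqrt_kappa /kappa.
by field; rewrite gt_eqF// lambda_min_gt0.
Qed.

Lemma tau_gt0 : 0 < tau. Proof. by rewrite divr_gt0// kappa_gt0. Qed.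

Lemma sigma_gt0 : 0 < sigma.
Proof. by rewrite divr_gt0// mulr_gt0 ?lambda_max_gt0 ?lambda_min_gt0. Qed.

Lemma sqr_MmxE x y : dotv (col_mx x y) (M *m col_mx x y) =
  kap * dotv x x + 2 * dotv x (A^T *m y) + (q * l) ^+ 2 * dotv y y.
Proof.
rewrite MmxE tauV sigmaV (dotvC y) dotv_mulmxl; ring.
Qed.

(** Completing the square leaves [|y|^2 / sigma - tau |A^T y|^2], nonnegative because
    [tau * lambda_max ^ 2 = 1 / sigma]. *)
Lemma psd_Mmx : psd M.
Proof.
split=> [|v].
  by rewrite /Mmx tr_block_mx !tr_scalar_mx trmxK.
rewrite -(vsubmxK v) sqr_MmxE; set x := usubmx v; set y := dsubmx v.
have h : tau * dotv (A^T *m y) (A^T *m y) <= (q * l) ^+ 2 * dotv y y.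
  rewrite -!sqr_enorm.
  have : enorm (A^T *m y) ^+ 2 <= (L * enorm y) ^+ 2.
    rewrite ler_pXn2r ?nnegrE ?enorm_ge0 ?mulr_ge0 ?enorm_ge0 ?(ltW lambda_max_gt0)//.
    exact: enorm_tr_le.
  move=> /(ler_wpM2l (ltW tau_gt0)) h; rewrite (le_trans h)//.
  rewrite !exprMn sqr_sqrt_kappa mulrA ler_wpM2r ?sqr_ge0// le_eqVlt.
  apply/orP; left; apply/eqP; rewrite /kappa; field.
  by rewrite !gt_eqF ?lambda_max_gt0 ?lambda_min_gt0.
have := dotv_ge0 (x + tau *: (A^T *m y)).
rewrite -(@pmulr_rge0 _ kap) ?kappa_gt0//.
suff -> : kap * dotv (x + tau *: (A^T *m y)) (x + tau *: (A^T *m y)) =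
    kap * dotv x x + 2 * dotv x (A^T *m y) +
    tau * dotv (A^T *m y) (A^T *m y) by lra.
rewrite !dotv_lin (dotvC (A^T *m y) x); field.
by rewrite gt_eqF// kappa_gt0.
Qed.

Lemma normM_primal v : nM (col_mx v 0) = q * enorm v.
Proof.
rewrite /normM sqr_MmxE mulmx0 !dotv0r !mulr0 !addr0 -sqr_enorm.
by rewrite sqrtrM ?(ltW kappa_gt0)// sqrtr_sqr ger0_norm// enorm_ge0.
Qed.

Lemma normM_dual v : nM (col_mx 0 v) = q * l * enorm v.
Proof.
rewrite /normM sqr_MmxE !dotv0l !mulr0 !add0r -sqr_enorm -exprMn sqrtr_sqr.
rewrite ger0_norm// !mulr_ge0 ?enorm_ge0 ?sqrtr_ge0//.
exact: ltW lambda_min_gt0.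
Qed.

(** The mixed term is at most [|x|^2 + |A^T y|^2], which [kappa >= 1] absorbs; this doubles the
    diagonal part, whence [sqrt 2]. *)
Lemma normM_le z : dual_range A z ->
  nM z <= Num.sqrt 2 * q * enorm (col_mx (usubmx z) (A^T *m dsubmx z)).
Proof.
move=> hz.
have q0 := ltW sqrt_kappa_gt0.
rewrite -(@ler_pXn2r _ 2) ?nnegrE ?sqrtr_ge0 ?mulr_ge0 ?enorm_ge0 ?sqrtr_ge0//.
rewrite sqr_sqrtr; last by have [_] := psd_Mmx; apply.
rewrite -{1 2}(vsubmxK z) sqr_MmxE !exprMn sqr_sqrt_kappa sqr_sqrtr//.
rewrite sqr_enorm_col -!sqr_enorm.
set x := usubmx z; set g := A^T *m dsubmx z.
have := enorm_tr_ge A_neq0 hz; rewrite -/g => h.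
have {}h : (l * enorm (dsubmx z)) ^+ 2 <= enorm g ^+ 2.
  by rewrite ler_pXn2r ?nnegrE ?enorm_ge0 ?mulr_ge0 ?enorm_ge0 ?(ltW lambda_min_gt0).
move: h; rewrite exprMn => /(ler_wpM2l (ltW kappa_gt0)) h.
have h2 : 2 * dotv x g <= enorm x ^+ 2 + enorm g ^+ 2.
  by have := dotv_ge0 (x - g); rewrite !dotv_lin (dotvC g x) !sqr_enorm; lra.
have k1 := kappa_ge1 A_neq0.
have h3 : enorm x ^+ 2 + enorm g ^+ 2 <= kap * (enorm x ^+ 2 + enorm g ^+ 2).
  by rewrite ler_peMl// addr_ge0 ?sqr_ge0.
lra.
Qed.

Lemma dual_rangeB z z' :
  dual_range A z -> dual_range A z' -> dual_range A (z - z').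
Proof.
move=> [v hv] [v' hv']; exists (v - v').
by rewrite mulmxBr -hv -hv' linearB.
Qed.

Lemma normM_slack z z' : dual_range A z -> dual_range A z' ->
  nM (z - z') <= Num.sqrt 2 * q * enorm (W z - W z').
Proof.
move=> hz hz'; rewrite (le_trans (normM_le (dual_rangeB hz hz')))//.
apply: ler_wpM2l; first by rewrite mulr_ge0 ?sqrtr_ge0.
rewrite /slack_point opp_col_mx add_col_mx enorm_le !dotv_col_mx.
have -> : c - A^T *m dsubmx z - (c - A^T *m dsubmx z') =
   - (A^T *m dsubmx (z - z')).
  have -> : dsubmx (z - z') = dsubmx z - dsubmx z' by rewrite linearB.
  rewrite mulmxBr; move: (A^T *m _) (A^T *m _) => u v.
  by apply/colP => i; rewrite !mxE; ring.
by rewrite dotvNl dotvNr opprK (_ : usubmx (z - z') = usubmx z - usubmx z') ?linearB.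
Qed.

(** The vector [qvec] disappears because [A] maps it to [b] and because, lying in Im(A^T), it is
    orthogonal to [c]. *)
Lemma Gap_col x y : Gap A b c (col_mx x (c - A^T *m y)) = dotv c x - dotv b y.
Proof.
have [x0 hx0] := b_range.
rewrite /Gap col_mxKu col_mxKd !dotv_lin dotv_mulmxr trmxK.
rewrite /qvec (mulmx_pseudo_solution hx0).
rewrite -mulmxA (dotv_mulmxl A^T) trmxK c_null dotv0r; ring.
Qed.

(** This makes the origin the test point that turns a normalized gap bound into a bound on [Gap]. *)
Lemma gapL0 z : gapL z 0 = Gap A b c (W z).
Proof.
by rewrite Gap_col /gapL /Lagr !linear0 !dotv_lin addr0 !subr0 add0r.
Qed.

(** Projecting the multiplier onto the range of [A] leaves [A^T y] unchanged. *)
Lemma Vd_dual s : Vd A c s -> exists2 y, s = c - A^T *m y &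
  exists v : 'cV[R]_n, y = A *m v.
Proof.
move=> [y ->]; exists (- (A *m (mp_inverse A *m y))).
  by rewrite mulmxN opprK !mulmxA -(mulmxA A^T) tr_mulmx_mp.
by exists (- (mp_inverse A *m y)); rewrite mulmxN.
Qed.

Lemma Vd_slack z : Vd A c (dsubmx (W z)).
Proof. by rewrite col_mxKd; exists (- dsubmx z); rewrite mulmxN. Qed.

Lemma Gap_Vpd w : Vpd A b c w -> Gap A b c w = dotv (usubmx w) (dsubmx w).
Proof.
move=> [xV /Vd_dual[y sE _]].
rewrite -[in LHS](vsubmxK w) sE Gap_col !dotv_lin dotv_mulmxr trmxK xV.
by rewrite (dotvC c).
Qed.

Lemma Gap_ge0 w : feasible A b c Kp w -> 0 <= Gap A b c w.
Proof. by move=> [wV [wp wd]]; rewrite Gap_Vpd//; exact: wd. Qed.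

(** Three displacements extract the optimality conditions: the residual [b - A x] in the dual block
    gives primal feasibility, cone directions in the primal block give dual feasibility, and [- x]
    gives complementarity. *)
Lemma saddleP z : saddle A b c Kp z -> Wstar A b c Kp (W z).
Proof.
move=> [Kz hz].
have h v dy : Kp (usubmx z + v) ->
    dotv (b - A *m usubmx z) dy - dotv (c - A^T *m dsubmx z) v <= 0.
  move=> Kv; have := hz (col_mx (usubmx z + v) (dsubmx z + dy)).
  rewrite col_mxKu gapLE col_mxKu col_mxKd => /(_ Kv).
  by rewrite !(addrC _ (- _)) !addKr.
have Axb : A *m usubmx z = b.
  apply/esym/eqP; rewrite -subr_eq0; apply/eqP/dotv_eq0/eqP.
  rewrite eq_le dotv_ge0 andbT.
  have := h 0 (b - A *m usubmx z); rewrite addr0 dotv0r subr0; exact.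
have sd : Kd Kp (c - A^T *m dsubmx z).
  move=> v Kv; have := h v 0 (coneD Kp_cone Kz Kv).
  by rewrite dotv0r sub0r oppr_le0 dotvC.
have s0 : dotv (usubmx z) (c - A^T *m dsubmx z) = 0.
  apply/eqP; rewrite eq_le sd// andbT.
  have := h (- usubmx z) 0; rewrite subrr => /(_ (cone0 Kp_cone Kp_ne)).
  by rewrite dotv0r sub0r dotvNr opprK dotvC.
have wV : Vpd A b c (W z) by split; [rewrite col_mxKu|exact: Vd_slack].
split; first by split=> //; split; rewrite ?col_mxKu ?col_mxKd.
by rewrite /= Gap_Vpd// col_mxKu col_mxKd.
Qed.

Lemma Wstar_saddle w : Wstar A b c Kp w ->
  exists z, [/\ saddle A b c Kp z, dual_range A z & W z = w].
Proof.
move=> [[wV [wp wd]] /= g0]; have [xV sV] := wV.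
have [y sE yr] := Vd_dual sV; exists (col_mx (usubmx w) y).
have Ww : W (col_mx (usubmx w) y) = w.
  by rewrite /slack_point col_mxKu col_mxKd -sE vsubmxK.
split=> //; last by rewrite /dual_range col_mxKd.
split=> [|zh Kzh]; first by rewrite col_mxKu.
rewrite gapLE col_mxKu col_mxKd xV subrr dotv0l sub0r oppr_le0 -sE dotvC.
move: g0; rewrite Gap_Vpd// => g0.
by rewrite dotvDl dotvNl g0 subr0; exact: wd.
Qed.

(** The correction is taken in the row space: there [lambda_min] bounds its length, and [c], being
    in Null(A), does not see it. *)
Lemma projection_Vp x : exists2 x', A *m x' = b /\ dotv c x' = dotv c x &
  l * enorm (x - x') <= enorm (b - A *m x).
Proof.
have [x0 hx0] := b_range.
pose u := rowproj A *m (x0 - x); exists (x + u); first split.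
- rewrite mulmxDr mulmxA mulmx_rowproj mulmxBr hx0.
  by rewrite addrC subrK.
- rewrite dotvDr /u (dotv_mulmxr (rowproj A)) tr_rowproj /rowproj -mulmxA c_null.
  by rewrite mulmx0 dotv0l addr0.
have [_ h _] := lambda_minP A_neq0.
have Au : A *m u = b - A *m x by rewrite /u mulmxA mulmx_rowproj mulmxBr hx0.
by rewrite opprD addNKr enormN -Au h// /u mulmxA rowprojK.
Qed.

Section rho_bounds.
Variables (z : 'cV[R]_(n + m)) (r p : R).
Hypothesis (r0 : 0 < r) (Kz : Kp (usubmx z)).
Hypothesis gap_bound : forall zh, Kp (usubmx zh) -> nM (zh - z) <= r ->
  gapL z zh <= p * r.

Lemma gap_bound_ge0 : 0 <= p.
Proof.
have := gap_bound Kz; rewrite subrr /normM mulmx0 dotv0l sqrtr0 (ltW r0).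
move=> /(_ isT); rewrite gapLE !subrr !dotv0r subrr.
by rewrite pmulr_lge0.
Qed.

(** The test displacement is the residual itself in the dual block, scaled to M-norm exactly [r]. *)
Lemma primal_residual : enorm (b - A *m usubmx z) <= q * l * p.
Proof.
set d := b - _; have ql0 : 0 < q * l.
  by rewrite mulr_gt0 ?sqrt_kappa_gt0 ?lambda_min_gt0.
have [d0|d0] := eqVneq (enorm d) 0.
  by rewrite d0 mulr_ge0 ?(ltW ql0)// gap_bound_ge0.
have {}d0 : 0 < enorm d by rewrite lt_def d0 enorm_ge0.
pose t := r / (q * l * enorm d).
have t0 : 0 < t by rewrite divr_gt0// mulr_gt0.
have := @gap_bound (col_mx (usubmx z) (dsubmx z + t *: d)).
rewrite col_mxKu gapLE col_mxKu col_mxKd => /(_ Kz).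
have -> : col_mx (usubmx z) (dsubmx z + t *: d) - z = col_mx 0 (t *: d).
  by rewrite -{3}(vsubmxK z) opp_col_mx add_col_mx subrr addrC addKr.
have -> : nM (col_mx 0 (t *: d)) = r.
  rewrite normM_dual enormZ ger0_norm ?(ltW t0)//.
  by rewrite /t; field; rewrite !gt_eqF ?sqrt_kappa_gt0 ?lambda_min_gt0.
have -> : dsubmx z + t *: d - dsubmx z = t *: d by rewrite addrC addKr.
rewrite lexx => /(_ isT); rewrite subrr dotv0r subr0 dotvZr -sqr_enorm.
rewrite -/d.
have -> : t * enorm d ^+ 2 = enorm d / (q * l) * r.
  by rewrite /t; field; rewrite !gt_eqF ?sqrt_kappa_gt0 ?lambda_min_gt0.
by rewrite ler_pM2r// ler_pdivrMr// mulrC.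
Qed.

(** The projection [d] of [- s] on the cone measures the dual violation; moving along [d] keeps [x]
    in the cone, and [s . d = - |d|^2]. *)
Lemma dual_residual : enorm (eproj Kp (- (c - A^T *m dsubmx z))) <= q * p.
Proof.
set s := c - _; set d := eproj _ _; have q0 := sqrt_kappa_gt0.
have Kd : Kp d by exact: eproj_in.
have [d0|d0] := eqVneq (enorm d) 0.
  by rewrite d0 mulr_ge0 ?(ltW q0)// gap_bound_ge0.
have {}d0 : 0 < enorm d by rewrite lt_def d0 enorm_ge0.
pose t := r / (q * enorm d).
have t0 : 0 < t by rewrite divr_gt0// mulr_gt0.
have := @gap_bound (col_mx (usubmx z + t *: d) (dsubmx z)).
rewrite col_mxKu gapLE col_mxKu col_mxKd.
move=> /(_ (coneD Kp_cone Kz (coneZ Kp_cone (ltW t0) Kd))).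
have -> : col_mx (usubmx z + t *: d) (dsubmx z) - z = col_mx (t *: d) 0.
  by rewrite -{3}(vsubmxK z) opp_col_mx add_col_mx subrr addrC addKr.
have -> : nM (col_mx (t *: d) 0) = r.
  rewrite normM_primal enormZ ger0_norm ?(ltW t0)//.
  by rewrite /t; field; rewrite !gt_eqF.
have -> : usubmx z + t *: d - usubmx z = t *: d by rewrite addrC addKr.
rewrite lexx => /(_ isT); rewrite subrr dotv0r sub0r dotvZr -/s.
have -> : dotv s d = - enorm d ^+ 2.
  have := eproj_orth Kp_closed Kp_cone Kp_ne (- s); rewrite -/d !dotv_lin sqr_enorm.
  lra.
rewrite mulrN opprK.
have -> : t * enorm d ^+ 2 = enorm d / q * r.
  by rewrite /t; field; rewrite !gt_eqF.
by rewrite ler_pM2r// ler_pdivrMr// mulrC.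
Qed.

(** The test point is 0. When it is farther than [r], it is pulled back to M-distance [r], and
    linearity of the gap rescales the bound. *)
Lemma Gap_le_rho : Gap A b c (W z) <= p * Num.max r (nM z).
Proof.
have p0 := gap_bound_ge0; have z0 := normM_ge0 A tau sigma z.
have K0 : Kp (usubmx (0 : 'cV[R]_(n + m))) by rewrite linear0; exact: cone0.
rewrite -gapL0; have [zr|rz] := leP (nM z) r.
  apply: gap_bound => //.
  by rewrite sub0r (normMN psd_Mmx).
have nz := lt_trans r0 rz.
pose t := r / nM z.
have t0 : 0 <= t by rewrite divr_ge0// ltW.
have t1 : t <= 1 by rewrite /t ler_pdivrMr ?nz//; lra.
have := @gap_bound (z + t *: (0 - z)); rewrite gapL_segment usub_segment.
have -> : z + t *: (0 - z) - z = t *: (0 - z) by rewrite addrC addKr.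
have -> : nM (t *: (0 - z)) = r.
  have -> : nM (t *: (0 - z)) = `|t| * nM (0 - z).
    exact: (seminormZ _ _ psd_Mmx).
  by rewrite ger0_norm// sub0r (normMN psd_Mmx) /t mulfVK// gt_eqF.
rewrite lexx => /(_ (cone_conv Kp_cone _ Kz K0) isT); rewrite t0 t1 => /(_ isT).
by rewrite /t mulrAC ler_pdivrMr// (mulrC r) [leRHS]mulrAC ler_pM2r.
Qed.

End rho_bounds.

End residuals.

(** * Level sets *)

Section level_sets.
Context {R : realType} {m n : nat}.
Variables (A : 'M[R]_(m, n)) (b : 'cV[R]_m) (c : 'cV[R]_n) (Kp : set 'cV[R]_n).
Hypothesis A_neq0 : A != 0.
Hypothesis (Kp_closed : closed Kp) (Kp_cone : convex_cone Kp).
Hypothesis c_null : A *m c = 0.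

Notation Vpd := (Vpd A b c).
Notation Kpd := (Kpd Kp).
Notation feasible := (feasible A b c Kp).
Notation Gap := (Gap A b c).
Notation Wstar := (Wstar A b c Kp).
Notation Wlevel := (Wlevel A b c Kp).

(* The pairing [dotv u (swapv w)] is nonnegative on the cone and equals
   [Gap u + Gap w] on the affine space. *)
Definition swapv (w : 'cV[R]_(n + n)) : 'cV[R]_(n + n) :=
  col_mx (dsubmx w) (usubmx w).

Lemma dotv_swapv (w : 'cV[R]_(n + n)) : dotv (swapv w) (swapv w) = dotv w w.
Proof. by rewrite -{3 4}(vsubmxK w) !dotv_col_mx addrC. Qed.

Lemma enorm_swapv w : enorm (swapv w) = enorm w.
Proof. by rewrite /enorm dotv_swapv. Qed.

Lemma dotv_swapv_ge0 u w : Kpd u -> Kpd w -> 0 <= dotv u (swapv w).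
Proof.
move=> [up ud] [wp wd]; rewrite -(vsubmxK u) dotv_col_mx addr_ge0//.
  exact: wd.
by rewrite dotvC; exact: ud.
Qed.

Lemma KpdZ a w : 0 <= a -> Kpd w -> Kpd (a *: w).
Proof.
move=> a0 [wp wd]; split; rewrite linearZ/=; first exact: coneZ.
exact: dual_coneZ.
Qed.

Lemma KpdD u w : Kpd u -> Kpd w -> Kpd (u + w).
Proof.
move=> [up ud] [wp wd]; split; rewrite linearD/=; first exact: coneD.
exact: dual_coneD.
Qed.

Lemma GapZ a w : Gap (a *: w) = a * Gap w.
Proof. by rewrite /Defs.Gap !linearZ/= !dotvZr mulrDr. Qed.

Lemma GapD u w : Gap (u + w) = Gap u + Gap w.
Proof. by rewrite /Defs.Gap !linearD/= !dotvDr addrACA. Qed.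

Lemma Vpd_affine w u v B C : 0 <= B -> 0 <= C -> Vpd w -> Vpd u -> Vpd v ->
  Vpd ((1 + B + C)^-1 *: (w + B *: u + C *: v)).
Proof.
move=> B0 C0 [wp [wy wd]] [up [uy ud]] [vp [vy vd]].
have a0 : 1 + B + C != 0 by rewrite gt_eqF//; lra.
split; rewrite linearZ !linearD !linearZ/=.
  rewrite /Vp /= -scalemxAr !mulmxDr -!scalemxAr wp up vp.
  rewrite -{1}(scale1r b) -!scalerDl scalerA mulVf// scale1r//.
exists ((1 + B + C)^-1 *: (wy + B *: uy + C *: vy)).
rewrite wd ud vd.
have -> : c + A^T *m wy + B *: (c + A^T *m uy) + C *: (c + A^T *m vy) =
    (1 + B + C) *: c + A^T *m (wy + B *: uy + C *: vy).
  rewrite !mulmxDr -!scalemxAr.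
  move: (A^T *m _) (A^T *m _) (A^T *m _) => p q r.
  by apply/colP => i; rewrite !mxE; ring.
by rewrite scalerDr scalerA mulVf// scale1r scalemxAr.
Qed.

Hypothesis b_range : exists x0, A *m x0 = b.

(** Primal and dual differences are orthogonal; expanding that product leaves the cross pairing
    against the two complementarity products, which are the gaps. *)
Lemma Gap_swapv u w : Vpd u -> Vpd w ->
  dotv u (swapv w) = Gap u + Gap w.
Proof.
move=> uV wV; rewrite (Gap_Vpd c_null b_range uV) (Gap_Vpd c_null b_range wV).
have [up [uy ud]] := uV; have [wp [wy wd]] := wV.
rewrite -(vsubmxK u) dotv_col_mx !col_mxKu !col_mxKd.
have : dotv (usubmx u - usubmx w) (dsubmx u - dsubmx w) = 0.
  have -> : dsubmx u - dsubmx w = A^T *m (uy - wy).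
    by rewrite ud wd opprD addrACA subrr add0r mulmxBr.
  by rewrite dotv_mulmxr trmxK mulmxBr up wp subrr dotv0l.
by rewrite !dotv_lin (dotvC (dsubmx u)); lra.
Qed.

Section one_level.
Variables (d r : R) (wc ws : 'cV[R]_(n + n)).
Hypothesis (d0 : 0 < d) (r0 : 0 < r) (wcW : Wlevel d wc).
Hypothesis (ball_wc : eball wc r `<=` Kpd) (wsW : Wstar ws).

(** The center moved by [r] against [swapv ws] is still in the cone, and its pairing with [ws] is
    [Gap wc - r |ws|]. *)
Lemma radius_norm_le : r * enorm ws <= d.
Proof.
have [ws0|ws0] := eqVneq (enorm ws) 0; first by rewrite ws0 mulr0 ltW.
have {}ws0 : 0 < enorm ws by rewrite lt_def ws0 enorm_ge0.
have [[wcV _] /= wcd] := wcW; have [[wsV wsK] /= g0] := wsW.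
have h : Kpd (wc - (r / enorm ws) *: swapv ws).
  apply: ball_wc; rewrite /eball /= addrC addKr enormN enormZ enorm_swapv.
  by rewrite ger0_norm ?divr_ge0 ?enorm_ge0 ?(ltW r0)// divfK// gt_eqF.
have := dotv_swapv_ge0 h wsK; rewrite dotvDl Gap_swapv// g0 addr0 dotvNl dotvZl.
rewrite dotv_swapv -sqr_enorm.
have -> : r / enorm ws * enorm ws ^+ 2 = r * enorm ws by field; rewrite gt_eqF.
lra.
Qed.

(** Were [ws] interior to the ball, it could move a little against [swapv ws] inside the cone,
    although its pairing with itself is already 0. *)
Lemma radius_le_dist : 0 < enorm ws -> r <= enorm (wc - ws).
Proof.
move=> ws0; rewrite leNgt; apply/negP => lr.
have [[wsV wsK] /= g0] := wsW.
pose t := (r - enorm (wc - ws)) / enorm ws.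
have t0 : 0 < t by rewrite divr_gt0// subr_gt0.
have h : Kpd (ws - t *: swapv ws).
  apply: ball_wc; rewrite /eball /= addrAC (le_trans (enormD _ _))//.
  rewrite enormN enormZ enorm_swapv ger0_norm ?(ltW t0)// enormB.
  by rewrite /t divfK ?gt_eqF// addrC subrK.
have := dotv_swapv_ge0 h wsK; rewrite dotvDl Gap_swapv// g0 addr0 dotvNl dotvZl.
rewrite dotv_swapv -sqr_enorm add0r oppr_ge0 leNgt => /negP; apply.
by rewrite mulr_gt0// exprn_gt0.
Qed.

(* A convex combination of [w], the conic center [wc] and the optimal point [ws]:
   the ball around [wc] absorbs the cone violation [eta], while the vanishing gap
   of [ws] absorbs the gap excess [G]. *)
Lemma level_error_bound D w k eta G :
  (forall u v, Wlevel d u -> Wlevel d v -> enorm (u - v) <= D) ->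
  Vpd w -> Kpd k -> enorm (w - k) <= eta -> 0 <= G -> Gap w <= G ->
  exists2 v, Wlevel d v & enorm (w - v) <= D * (G / d + eta / r).
Proof.
move=> hD wV kK wk G0 wG.
have [[wcV wcK] /= wcd] := wcW; have [[wsV wsK] /= g0] := wsW.
have eta0 : 0 <= eta := le_trans (enorm_ge0 _) wk.
pose B := eta / r; pose C := G / d; pose a := 1 + B + C.
have B0 : 0 <= B by rewrite divr_ge0// ltW.
have C0 : 0 <= C by rewrite divr_ge0// ltW.
have a0 : 0 < a by rewrite /a; lra.
pose v := a^-1 *: (w + B *: wc + C *: ws).
have vK : Kpd v.
  apply: KpdZ; first by rewrite invr_ge0 ltW.
  apply: KpdD; last exact: KpdZ.
  have [eta00|eta00] := eqVneq eta 0.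
    move: wk; rewrite eta00 => wk.
    have : w - k = 0 by apply: enorm_eq0; apply/eqP; rewrite eq_le wk enorm_ge0.
    move=> /eqP; rewrite subr_eq0 => /eqP ->.
    by apply: KpdD => //; exact: KpdZ.
  have {}eta00 : 0 < eta by rewrite lt_def eta00.
  have -> : w + B *: wc = k + B *: (wc + (r / eta) *: (w - k)).
    rewrite scalerDr scalerA (_ : B * (r / eta) = 1); last first.
      by rewrite /B; field; rewrite !gt_eqF.
    by rewrite scale1r addrCA [k + _]addrC subrK addrC.
  apply: KpdD => //; apply: KpdZ => //; apply: ball_wc.
  rewrite /eball /= addrC addKr enormZ ger0_norm ?divr_ge0 ?(ltW r0)//.
  by rewrite mulrAC ler_pdivrMr// ler_pM2l.
have vV : Vpd v by exact: Vpd_affine.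
have vW : Wlevel d v.
  split; first by split.
  rewrite /= /v GapZ !GapD !GapZ g0 mulr0 addr0 mulrC ler_pdivrMr//.
  have h1 : B * Gap wc <= B * d by rewrite ler_wpM2l.
  have h2 : G = C * d by rewrite /C divfK// gt_eqF.
  rewrite /a !(mulrDr d) mulr1 (mulrC d C) -h2 (mulrC d B) addrC.
  by rewrite -addrA addrCA lerD// (le_trans wG)// lerDr ltW.
exists v => //.
(* This rearranges [a v = w + B wc + C ws]; both differences on the right lie within the level set,
   hence are at most [D]. *)
have -> : w - v = B *: (v - wc) + C *: (v - ws).
  have -> : w = a *: v - B *: wc - C *: ws.
    rewrite /v scalerA divff ?scale1r ?gt_eqF//.
    by apply/colP => i; rewrite !mxE; ring.
  by rewrite /a; apply/colP => i; rewrite !mxE; ring.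
rewrite (le_trans (enormD _ _))// !enormZ !ger0_norm// -/B -/C mulrDr addrC.
have h1 := hD _ _ vW wcW.
have wsl : Wlevel d ws by split; [exact: (proj1 wsW)|rewrite /= g0 ltW].
have h2 := hD _ _ vW wsl.
by rewrite !(mulrC D) lerD// ler_wpM2l.
Qed.

End one_level.

(** * Closedness and the limit of vanishing levels *)

Section closedness.

Lemma closed_eq_coord k l (f g : 'cV[R]_k -> 'cV[R]_l) :
  coord_cont f -> coord_cont g -> closed [set t | f t = g t].
Proof.
move=> cf cg; have -> : [set t | f t = g t] = [set t | enorm (f t - g t) <= 0].
  apply/seteqP; split=> t /= => [->|h]; first by rewrite subrr enorm0.
  apply/eqP; rewrite -subr_eq0; apply/eqP/enorm_eq0/eqP.
  by rewrite eq_le h enorm_ge0.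
apply: closed_le_cont; last exact: cst_continuous.
exact/continuous_enorm/coord_contB.
Qed.

(** Replaces the existential over multipliers by an equation, whose solution set is visibly
    closed. *)
Lemma Vd_rowproj s : Vd A c s <-> rowproj A *m (s - c) = s - c.
Proof.
split=> [[y ->]|h].
  by rewrite addrC addKr mulmxA rowproj_tr.
exists ((mp_inverse A)^T *m (s - c)).
by rewrite mulmxA -trmx_mul -/(rowproj A) tr_rowproj h addrC subrK.
Qed.

Lemma closed_feasible : closed feasible.
Proof.
have cu : coord_cont (fun w : 'cV[R]_(n + n) => usubmx w).
  exact/coord_cont_usub/coord_cont_id.
have cd : coord_cont (fun w : 'cV[R]_(n + n) => dsubmx w).
  exact/coord_cont_dsub/coord_cont_id.
apply: closedI; apply: closedI.
- by apply: closed_eq_coord; [exact: coord_cont_mulmx|exact: coord_cont_cst].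
- have cdc : coord_cont (fun w : 'cV[R]_(n + n) => dsubmx w - c).
    by apply: coord_contB => //; exact: coord_cont_cst.
  rewrite (_ : (fun w => _) =
     [set w | rowproj A *m (dsubmx w - c) = dsubmx w - c]).
    by apply: closed_eq_coord => //; exact: coord_cont_mulmx.
  by apply/seteqP; split=> w /Vd_rowproj.
- exact: closed_preimage_coord cu Kp_closed.
- rewrite (_ : (fun w => _) =
    \bigcap_(x in Kp) [set w : 'cV[R]_(n + n) | 0 <= dotv x (dsubmx w)]).
    apply: closed_bigI => x _; apply: closed_le_cont; first exact: cst_continuous.
    by apply: continuous_dotv => //; exact: coord_cont_cst.
  by apply/seteqP; split=> w h x Kx; exact: h.
Qed.

Lemma continuous_Gap : continuous (Gap : 'cV[R]_(n + n) -> R).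
Proof.
pose V : topologicalType := 'cV[R]_(n + n).
have h1 : continuous (fun w : V => dotv c (usubmx w)).
  apply: continuous_dotv; first exact: coord_cont_cst.
  exact/coord_cont_usub/coord_cont_id.
have h2 : continuous (fun w : V => dotv (qvec A b) (dsubmx w)).
  apply: continuous_dotv; first exact: coord_cont_cst.
  exact/coord_cont_dsub/coord_cont_id.
by move=> w; exact: cvgD (h1 w) (h2 w).
Qed.

Lemma closed_Wstar : closed Wstar.
Proof.
rewrite (_ : Wstar = feasible `&` [set w | Gap w <= 0]); last first.
  apply/seteqP; split=> w [wF /= h]; split=> //=; first by rewrite h.
  by apply/eqP; rewrite eq_le h (Gap_ge0 c_null b_range wF).
apply: closedI; first exact: closed_feasible.
by apply: closed_le_cont; [exact: continuous_Gap|exact: cst_continuous].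
Qed.

(* The levels shrink to [Wstar], and the closed ball is compact. *)
Lemma level_limit w B :
  (forall d, 0 < d -> exists2 v, Wlevel d v & enorm (w - v) <= B) ->
  exists2 v, Wstar v & enorm (w - v) <= B.
Proof.
move=> h; pose S := feasible `&` [set v | enorm (w - v) <= B].
have cS : compact S.
  apply: (@bounded_closed_compact_cV _ _ _ (enorm w + B)).
    apply: closedI; first exact: closed_feasible.
    apply: closed_le_cont; last exact: cst_continuous.
    apply: continuous_enorm; apply: coord_contB; first exact: coord_cont_cst.
    exact: coord_cont_id.
  move=> v [_ /= vB]; rewrite -[v](subKr w) (le_trans (enormD _ _))//.
  by rewrite enormN lerD2l.
have [] := @compact_EVT_min _ R Gap S _ cS.
- by have [v [vF _] vB] := h 1 ltr01; exists v; split.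
- exact/continuous_subspaceT/continuous_Gap.
move=> v /set_mem[vF vB] hv; exists v => //; split=> //=.
apply/eqP; rewrite eq_le (Gap_ge0 c_null b_range vF) andbT.
rewrite leNgt; apply/negP => g0.
have [u [uF /= ug] uB] := h (Gap v / 2) (divr_gt0 g0 (ltr0n _ 2)).
have := hv u (mem_set (conj uF uB : S u)); lra.
Qed.

End closedness.

End level_sets.

(** * Consequences of the Slater points *)

(** Saddle optimality consists of closed conditions, so a cluster point in this form suffices and no
    subsequence is extracted. *)
Lemma compact_seq_cluster {R : realType} k (u : nat -> 'cV[R]_k) B :
  (forall i, enorm (u i) <= B) ->
  exists z, forall (C : set 'cV[R]_k) N, closed C ->
    (forall i, (N <= i)%N -> C (u i)) -> C z.
Proof.
move=> uB.
have cS : compact [set v : 'cV[R]_k | enorm v <= B].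
  apply: (@bounded_closed_compact_cV _ _ _ B) => //.
  apply: closed_le_cont; last exact: cst_continuous.
  exact/continuous_enorm/coord_cont_id.
have FA : (u @ \oo) [set v : 'cV[R]_k | enorm v <= B].
  by exists 0%N => // i _; exact: uB.
have [z [_ zc]] := cS _ _ FA; exists z => C N cC CN; apply: cC => Q zQ.
apply: zc => //; exists N => // i; exact: CN.
Qed.

Section slater.
Context {R : realType} {m n : nat}.
Variables (A : 'M[R]_(m, n)) (b : 'cV[R]_m) (c : 'cV[R]_n) (Kp : set 'cV[R]_n).
Hypothesis A_neq0 : A != 0.
Hypothesis (Kp_closed : closed Kp) (Kp_cone : convex_cone Kp).
Hypothesis c_null : A *m c = 0.
Variables (xS sS : 'cV[R]_n) (e : R).
Hypothesis (e0 : 0 < e) (xSV : Vp A b xS) (sSV : Vd A c sS).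
Hypothesis (xS_int : forall x, enorm (x - xS) <= e -> Kp x).
Hypothesis (sS_int : forall s, enorm (s - sS) <= e -> Kd Kp s).

Notation tau := (1 / kappa A).
Notation sigma := (1 / (lambda_max A * lambda_min A)).
Notation nM := (normM A tau sigma).
Notation q := (Num.sqrt (kappa A)).
Notation W := (slack_point A c).
Notation gapL := (gapL A b c).
Notation Gap := (Gap A b c).
Notation Wstar := (Wstar A b c Kp).
Notation Wlevel := (Wlevel A b c Kp).
Notation Kpd := (Kpd Kp).
Notation avg := (average A b c Kp tau sigma).

Lemma slater_range : exists x0, A *m x0 = b. Proof. by exists xS. Qed.

Lemma slater_xS : Kp xS.
Proof. by apply: xS_int; rewrite subrr enorm0 ltW. Qed.

Lemma slater_ne : Kp !=set0. Proof. by exists xS; exact: slater_xS. Qed.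

Lemma enorm_normalize k (v : 'cV[R]_k) a : 0 <= a ->
  exists2 u, enorm u <= a & dotv u v = a * enorm v.
Proof.
move=> a0; have [v0|v0] := eqVneq (enorm v) 0.
  by exists 0; rewrite ?enorm0// dotv0l v0 mulr0.
exists ((a / enorm v) *: v).
  by rewrite enormZ ger0_norm ?divr_ge0 ?enorm_ge0// divfK.
by rewrite dotvZl -sqr_enorm; field.
Qed.

Lemma slater_dual_growth x : Kp x -> e * enorm x <= dotv x sS.
Proof.
move=> Kx; have [u ue <-] := enorm_normalize x (ltW e0).
have : Kd Kp (sS - u) by apply: sS_int; rewrite addrC addKr enormN.
by move=> /(_ _ Kx); rewrite dotvDr dotvNr subr_ge0 dotvC.
Qed.

(* Testing the gap at the points [xS + d] for small [d] bounds both [x] and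
   [A^T y]. *)
Lemma gapL_slater_bound C : exists B, forall z, dual_range A z -> Kp (usubmx z) ->
  (forall zh, Kp (usubmx zh) -> gapL z zh <= nM zh ^+ 2 * C) -> 0 <= C -> enorm z <= B.
Proof.
have [y0 sE _] := Vd_dual sSV.
(* Bounds the gap at the test point plus the terms of its expansion that do not involve [z]; what
   remains on the other side is at least [e |x| + e |A^T y|]. *)
pose K := (nM (col_mx xS y0) + q * e) ^+ 2 * C + dotv c xS + enorm c * e - dotv b y0.
have l0 := lambda_min_gt0 A_neq0.
exists (K / e + K / e / lambda_min A) => z zr Kz hz C0.
set x := usubmx z; set g := A^T *m dsubmx z.
have [d de dg] := enorm_normalize g (ltW e0).
have Kd : Kp (xS + d) by apply: xS_int; rewrite addrC addKr.
have := hz (col_mx (xS + d) y0); rewrite col_mxKu => /(_ Kd).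
have nMd : nM (col_mx d 0) <= q * e.
  by rewrite normM_primal// ler_wpM2l// sqrtr_ge0.
have nMz : nM (col_mx (xS + d) y0) ^+ 2 * C <= (nM (col_mx xS y0) + q * e) ^+ 2 * C.
  rewrite ler_wpM2r//.
  rewrite ler_pXn2r ?nnegrE ?addr_ge0 ?normM_ge0 ?mulr_ge0 ?sqrtr_ge0 ?(ltW e0)//.
  have -> : col_mx (xS + d) y0 = col_mx xS y0 + col_mx d 0.
    by rewrite add_col_mx addr0.
  by rewrite (le_trans (seminormD _ _ (psd_Mmx A_neq0)))// lerD2l.
move=> /le_trans /(_ nMz) {nMz nMd}.
have -> : gapL z (col_mx (xS + d) y0) =
    dotv x sS + dotv d g - dotv c xS - dotv c d + dotv b y0.
  rewrite /gapL /Lagr col_mxKu col_mxKd -/x -/g sE !dotv_lin (dotvC x c).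
  have -> : dotv xS g = dotv b (dsubmx z).
    by rewrite /g (dotv_mulmxr A^T) trmxK xSV.
  ring.
have := slater_dual_growth Kz; rewrite -/x dg.
have := dotv_CS c d; have cd : enorm c * enorm d <= enorm c * e.
  by rewrite ler_wpM2l// enorm_ge0.
move=> h1 h2 h3.
have {h1 h2 h3} h : e * enorm x + e * enorm g <= K by rewrite /K; lra.
have x0 := enorm_ge0 x; have g0 := enorm_ge0 g.
have ex0 := mulr_ge0 (ltW e0) x0; have eg0 := mulr_ge0 (ltW e0) g0.
have hx : enorm x <= K / e by rewrite ler_pdivlMr// mulrC; lra.
have hg : enorm g <= K / e by rewrite ler_pdivlMr// mulrC; lra.
have := enorm_tr_ge A_neq0 zr; rewrite -/g => hy.
rewrite -[z]vsubmxK (le_trans (enorm_col_le _ _))// lerD// ler_pdivlMr// mulrC.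
exact: le_trans hg.
Qed.

Lemma dual_range0 : dual_range A (0 : 'cV[R]_(n + m)).
Proof. by exists 0; rewrite linear0 mulmx0. Qed.

Lemma saddle_exists : exists z, saddle A b c Kp z.
Proof.
have tau0 := tau_gt0 A_neq0; have sigma0 := sigma_gt0 A_neq0.
have pM := psd_Mmx A_neq0.
pose u k := avg 0 k.+1.
have gu k zh : Kp (usubmx zh) -> gapL (u k) zh <= nM zh ^+ 2 / (2 * k.+1%:R).
  move=> Kzh; have := avg_gap b c Kp_closed Kp_cone slater_ne tau0 sigma0 pM 0
    (ltn0Sn k) Kzh.
  by rewrite sub0r (normMN pM).
have Ku k : Kp (usubmx (u k)) by apply: usub_avg => //; exact: slater_ne.
have [B hB] := gapL_slater_bound 2^-1.
have uB k : enorm (u k) <= B.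
  apply: hB => //; first
    exact: (dual_range_avg c Kp tau sigma slater_range k.+1 dual_range0).
  move=> zh Kzh; rewrite (le_trans (gu k zh Kzh))// ler_wpM2l ?sqr_ge0//.
  by rewrite lef_pV2 ?posrE ?mulr_gt0// ler_peMr// ler1n.
have [z hz] := compact_seq_cluster uB; exists z; split.
  apply: (hz [set v | Kp (usubmx v)] 0%N) => [|i _]; last exact: Ku.
  apply: closed_preimage_coord Kp_closed; exact/coord_cont_usub/coord_cont_id.
move=> zh Kzh; rewrite leNgt; apply/negP => g0.
set g := gapL z zh in g0; pose N := nM zh ^+ 2 / (2 * g).
have N0 : 0 <= N by rewrite divr_ge0 ?sqr_ge0// mulr_ge0// ltW.
(* Past this index the gap bound of the averages is below the supposed positive gap [g]; as a closed
   condition on a tail, it passes to [z]. *)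
have NK := archi_boundP N0; set k := Num.bound N in NK.
have : g <= nM zh ^+ 2 / (2 * k.+1%:R).
  apply: (hz [set v | gapL v zh <= nM zh ^+ 2 / (2 * k.+1%:R)] k).
    apply: closed_le_cont; last exact: cst_continuous.
    rewrite (_ : (fun _ => _) = (fun v : 'cV[R]_(n + m) =>
       dotv (col_mx (c - A^T *m dsubmx zh) (A *m usubmx zh - b)) v +
       (dotv b (dsubmx zh) - dotv c (usubmx zh)))); last first.
      by apply/funext => v; rewrite gapL_lin.
    pose V : topologicalType := 'cV[R]_(n + m).
    have hc a : continuous (fun v : V => dotv a v).
      by apply: continuous_dotv; [exact: coord_cont_cst|exact: coord_cont_id].
    by move=> v; exact: cvgD (hc _ v) (cvg_cst _).
  move=> i ki; rewrite /= (le_trans (gu i zh Kzh))// ler_wpM2l ?sqr_ge0//.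
  by rewrite lef_pV2 ?posrE ?mulr_gt0// ler_pM2l// ler_nat.
rewrite leNgt => /negP; apply.
rewrite ltr_pdivrMr ?mulr_gt0//.
have : N < k.+1%:R by rewrite (lt_le_trans NK)// ler_nat.
rewrite /N ltr_pdivrMr ?mulr_gt0// => h; rewrite (lt_le_trans h)//; lra.
Qed.

Lemma Wstar_min : exists2 w, Wstar w & forall v, Wstar v -> enorm w <= enorm v.
Proof.
have [z zs] := saddle_exists.
have ne : Wstar !=set0.
  by exists (W z); exact: (saddleP Kp_cone slater_ne c_null slater_range zs).
have [w wW hw] := nearest_point 0
  (closed_Wstar Kp_closed c_null slater_range) ne.
by exists w => // v /hw; rewrite !sub0r !enormN.
Qed.

Section levels.
Variable ws : 'cV[R]_(n + n).
Hypothesis (wsW : Wstar ws) (ws_gt0 : 0 < enorm ws).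

Lemma interior_level d : 0 < d ->
  exists r wc, [/\ 0 < r, Wlevel d wc & eball wc r `<=` Kpd].
Proof.
move=> d0; have [[wsV wsK] /= g0] := wsW.
pose wS := col_mx xS sS.
have ballS : eball wS e `<=` Kpd.
  move=> w; rewrite /eball /= -[w]vsubmxK opp_col_mx add_col_mx => h.
  split; rewrite ?col_mxKu ?col_mxKd.
    by apply: xS_int; exact: le_trans (enorm_colu _ _) h.
  by apply: sS_int; exact: le_trans (enorm_cold _ _) h.
have wSK : Kpd wS by apply: ballS; rewrite /eball /= subrr enorm0 ltW.
have wSV : Vpd A b c wS by split; rewrite ?col_mxKu ?col_mxKd.
have gS : 0 <= Gap wS.
  exact: (@Gap_ge0 _ _ _ A b c Kp c_null slater_range wS (conj wSV wSK)).
(* This weight on [ws] brings the gap [Gap wS / (1 + a)] to at most [d]; the Slater ball shrinks by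
   the same factor. The coefficient 0 below only fits the three-point shape of [Vpd_affine]. *)
pose a := Gap wS / d.
have a0 : 0 <= a by rewrite divr_ge0// ltW.
have a1 : 0 < 1 + 0 + a by lra.
pose wc := (1 + 0 + a)^-1 *: (wS + 0 *: wS + a *: ws).
exists ((1 + 0 + a)^-1 * e), wc; split.
- by rewrite mulr_gt0// invr_gt0.
- have wcK : Kpd wc.
    apply: (KpdZ Kp_cone); first by rewrite invr_ge0 ltW.
    by rewrite scale0r addr0; apply: (KpdD Kp_cone) => //; exact: (KpdZ Kp_cone).
  split; first by split=> //; exact: Vpd_affine.
  rewrite /= /wc GapZ !GapD !GapZ g0 mulr0 mul0r !addr0 mulrC.
  rewrite ler_pdivrMr; last by move: a1; rewrite addr0.
  have -> : d * (1 + a) = d + Gap wS by rewrite /a; field; rewrite gt_eqF.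
  by rewrite lerDr ltW.
move=> u; rewrite /eball /= => h.
have -> : u = (1 + 0 + a)^-1 *: ((wS + (1 + 0 + a) *: (u - wc)) + a *: ws).
  rewrite (addrAC wS) scalerDr (scalerA _ _ (u - wc)) mulVf ?gt_eqF// scale1r.
  by rewrite /wc scale0r (addr0 wS) addrCA subrr addr0.
apply: (KpdZ Kp_cone); first by rewrite invr_ge0 ltW.
apply: (KpdD Kp_cone); last exact: (KpdZ Kp_cone).
apply: ballS; rewrite /eball /= addrC addKr enormZ ger0_norm ?(ltW a1)//.
by rewrite mulrC -ler_pdivlMr// mulrC.
Qed.

Notation ratio := (fun d => (diam_level A b c Kp d / conic_radius A b c Kp d)%E).

Lemma conic_radiusP d : 0 < d ->
  exists2 rd : R, 0 < rd & conic_radius A b c Kp d = rd%:E.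
Proof.
move=> d0; have [r [wc [r0 wcW hb]]] := interior_level d0.
have lb : (r%:E <= conic_radius A b c Kp d)%E.
  by apply: ereal_sup_ubound; exists r => //; split; [exact: ltW|exists wc].
have ub : (conic_radius A b c Kp d <= (d / enorm ws)%:E)%E.
  apply: ge_ereal_sup => _ [s [s0 [w wW wb]] <-].
  rewrite lee_fin ler_pdivlMr//.
  have [->|sn0] := eqVneq s 0; first by rewrite mul0r ltW.
  have sp : 0 < s by rewrite lt_def sn0.
  exact: (radius_norm_le c_null slater_range d0 sp wW wb wsW).
case: (conic_radius A b c Kp d) lb ub => [rd| |].
- by rewrite !lee_fin => h _; exists rd => //; exact: lt_le_trans h.
- by rewrite leye_eq.
- by rewrite leeNy_eq.
Qed.

(** [ws] belongs to the level set but to the interior of no ball inside the cone, so each admissible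
    radius is at most a distance within the set. *)
Lemma ratio_ge1 d : 0 < d -> (1 <= ratio d)%E.
Proof.
move=> d0; have [rd rd0 rdE] := conic_radiusP d0.
rewrite rdE inver gt_eqF// lee_pdivlMr// mul1e -rdE; apply: ge_ereal_sup.
move=> _ [r [r0 [w wW wb]] <-].
have [wsF /= g0] := wsW.
have wsl : Wlevel d ws by split=> //; rewrite /= g0 ltW.
apply: (@le_trans _ _ (enorm (w - ws))%:E); last first.
  by apply: ereal_sup_ubound; exists (w, ws).
rewrite lee_fin; have [->|rn0] := eqVneq r 0; first exact: enorm_ge0.
have rp : 0 < r by rewrite lt_def rn0.
exact: (radius_le_dist c_null slater_range wb wsW ws_gt0).
Qed.

Lemma liminf_ge1 : (1 <= liminf_level_ratio A b c Kp)%E.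
Proof.
rewrite /liminf_level_ratio limf_einfE.
apply: (@le_trans _ _ (ereal_inf (ratio @` [set d | 0 < d]))).
  by apply: le_ereal_inf_tmp => _ [d /= d0 <-]; exact: ratio_ge1.
apply: ereal_sup_ubound; exists [set d | 0 < d] => //.
exact: nbhs_right_gt.
Qed.

Lemma liminf_level (l' : R) d0 : (liminf_level_ratio A b c Kp < l'%:E)%E ->
  0 < d0 -> exists d r wc D, [/\ 0 < d <= d0, 0 < r, Wlevel d wc,
    eball wc r `<=` Kpd & D < l' * r /\
    forall u v, Wlevel d u -> Wlevel d v -> enorm (u - v) <= D].
Proof.
move=> hl d00.
have [d [dp dd0 hd]] : exists d, [/\ 0 < d, d <= d0 & (ratio d < l'%:E)%E].
  apply: contrapT => hn; move: hl; apply/negP; rewrite -leNgt.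
  rewrite /liminf_level_ratio limf_einfE.
  apply: (@le_trans _ _ (ereal_inf (ratio @` [set d | 0 < d <= d0]))).
    apply: le_ereal_inf_tmp => _ [d /= /andP[dp dd0] <-].
    by rewrite leNgt; apply/negP => h; apply: hn; exists d.
  apply: ereal_sup_ubound; exists [set d | 0 < d <= d0] => //.
  near=> d; apply/andP; split; near: d; first exact: nbhs_right_gt.
  exact: nbhs_right_le.
have [rd rd0 rdE] := conic_radiusP dp.
move: hd; rewrite rdE inver gt_eqF// lte_pdivrMr// -EFinM => hD.
have hd2 u v : Wlevel d u -> Wlevel d v ->
    ((enorm (u - v))%:E <= diam_level A b c Kp d)%E.
  by move=> uW vW; apply: ereal_sup_ubound; exists (u, v).
have wsl : Wlevel d ws.
  by have [wsF /= g0] := wsW; split=> //; rewrite /= g0 ltW.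
have := hd2 _ _ wsl wsl; move: hD hd2.
case: (diam_level A b c Kp d) => [D| |] //; rewrite lte_fin lee_fin subrr enorm0.
move=> hD hd2 D0.
have l0 : 0 < l'.
  by have := le_lt_trans D0 hD; rewrite pmulr_lgt0.
(* The conic radius is not assumed attained; the strict inequality [D < l' * rd] leaves room for an
   actual ball. *)
have : ((D / l')%:E < conic_radius A b c Kp d)%E.
  by rewrite rdE lte_fin ltr_pdivrMr// mulrC.
move=> /ereal_sup_gt[_ [r [r0 [wc wcW hb]] <-]]; rewrite lte_fin => hr.
have rp : 0 < r by rewrite (le_lt_trans _ hr)// divr_ge0// ltW.
exists d, r, wc, D; split=> //; first by rewrite dp.
split; first by rewrite mulrC -ltr_pdivrMr.
by move=> u v uW vW; rewrite -lee_fin hd2.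
Unshelve. all: by end_near.
Qed.

(** The trailing 1 pays for moving [x] onto its affine space. In the factor 3, a 2 comes from the
    gap excess and a 1 from the cone violation [sqrt 2 * q * p] of the moved point. *)
Lemma error_bound z r p (l' : R) : 0 < r -> Kp (usubmx z) ->
  (forall zh, Kp (usubmx zh) -> nM (zh - z) <= r -> gapL z zh <= p * r) ->
  Gap (W z) <= 2 * Num.sqrt 2 * q * p * enorm ws ->
  (liminf_level_ratio A b c Kp < l'%:E)%E ->
  exists2 w, Wstar w & enorm (W z - w) <= (3 * Num.sqrt 2 * l' + 1) * (q * p).
Proof.
move=> r0 Kz hz gz hl.
have q0 := sqrt_kappa_gt0 A_neq0; have l0 := lambda_min_gt0 A_neq0.
have p0 := gap_bound_ge0 r0 Kz hz.
have s2 : Num.sqrt 2 ^+ 2 = 2 :> R by rewrite sqr_sqrtr.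
have s20 : 0 <= Num.sqrt 2 :> R by rewrite sqrtr_ge0.
have hp := primal_residual A_neq0 r0 Kz hz.
have hd := dual_residual A_neq0 Kp_closed Kp_cone slater_ne r0 Kz hz.
set s := c - A^T *m dsubmx z in hd.
have [x' [x'V cx'] hx'] := projection_Vp A_neq0 c_null slater_range (usubmx z).
have {}hx' : enorm (usubmx z - x') <= q * p.
  rewrite -(ler_pM2l l0) (le_trans hx')// (le_trans hp)//.
  by rewrite mulrA (mulrC q).
pose w := col_mx x' s; pose k := col_mx (usubmx z) (s + eproj Kp (- s)).
have wV : Vpd A b c w.
  by split; rewrite ?col_mxKu ?col_mxKd//; exists (- dsubmx z); rewrite mulmxN.
have kK : Kpd k.
  split; rewrite ?col_mxKu ?col_mxKd//.
  exact: dual_cone_proj Kp_closed Kp_cone slater_ne _.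
have wk : enorm (w - k) <= Num.sqrt 2 * (q * p).
  rewrite -(@ler_pXn2r _ 2) ?nnegrE ?enorm_ge0 ?mulr_ge0 ?(ltW q0)//.
  rewrite opp_col_mx add_col_mx sqr_enorm_col exprMn s2.
  rewrite opprD addNKr enormN enormB mulr_natl mulr2n.
  by rewrite lerD// ler_pXn2r ?nnegrE ?enorm_ge0 ?mulr_ge0 ?(ltW q0).
have wz : Gap w = Gap (W z).
  by rewrite /w /s !(Gap_col c_null slater_range) cx'.
have Wzw : enorm (W z - w) <= q * p.
  rewrite opp_col_mx add_col_mx subrr; apply: le_trans hx'.
  by rewrite enorm_le dotv_col_mx dotv0l addr0.
have G0 : 0 <= 2 * Num.sqrt 2 * q * p * enorm ws.
  by rewrite !mulr_ge0 ?enorm_ge0 ?(ltW q0).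
have [v vW hv] : exists2 v, Wstar v &
    enorm (w - v) <= 3 * Num.sqrt 2 * l' * (q * p).
  apply: (level_limit Kp_closed c_null slater_range) => d0 d00.
  have [d [rd [wc [D [/andP[dp dd0] rd0 wcW hb [hD hdD]]]]]] := liminf_level hl d00.
  have [v vW hv] := level_error_bound Kp_cone dp rd0 wcW hb wsW hdD wV kK wk
    G0 (eq_ind_r (fun t => t <= _) gz wz : Gap w <= _).
  exists v; first by case: vW => vF /= vd; split=> //=; exact: le_trans dd0.
  rewrite (le_trans hv)//.
  have := radius_norm_le c_null slater_range dp rd0 wcW hb wsW => hrd.
  have D0 : 0 <= D by have := hdD _ _ wcW wcW; rewrite subrr enorm0.
  (* [rd * |ws| <= d] trades [|ws| / d] for [1 / rd], putting both error terms over the same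
     radius. *)
  have h1 : 2 * Num.sqrt 2 * q * p * enorm ws / d <= 2 * Num.sqrt 2 * (q * p) / rd.
    rewrite ler_pdivrMr// [leRHS]mulrAC ler_pdivlMr//.
    have h : 0 <= 2 * Num.sqrt 2 * q * p by rewrite !mulr_ge0 ?(ltW q0).
    by have := ler_wpM2l h hrd; lra.
  have h2 : D * (2 * Num.sqrt 2 * q * p * enorm ws / d + Num.sqrt 2 * (q * p) / rd)
     <= D * (3 * Num.sqrt 2 * (q * p) / rd).
    by rewrite ler_wpM2l//; lra.
  rewrite (le_trans h2)// (_ : D * _ = 3 * Num.sqrt 2 * (q * p) * D / rd); last by ring.
  rewrite ler_pdivrMr//.
  have h3 : 0 <= 3 * Num.sqrt 2 * (q * p) by rewrite !mulr_ge0 ?(ltW q0).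
  have := ler_wpM2l h3 (ltW hD); lra.
exists v => //; rewrite (le_trans (enorm_triangle _ w _))// mulrDl mul1r addrC.
exact: lerD.
Qed.

End levels.

End slater.

(** * Counting iterations *)

(** From [1 - 1/6 <= exp (-1/6)] follows [e <= (6/5)^6 < 2.99]; the same argument with fifths would
    give [(5/4)^5 > 3]. *)
Lemma expR1_le3 (R : realType) : expR 1 <= 3 :> R.
Proof.
have h : 5 / 6 <= expR (- (1 / 6)) :> R.
  by rewrite (le_trans _ (expR_ge1Dx _))//; lra.
have h6 : expR (1 / 6) <= 6 / 5 :> R.
  rewrite -[1 / 6]opprK expRN -[leRHS]invrK lef_pV2 ?posrE ?expR_gt0 ?invr_gt0//.
  by rewrite invf_div.
have -> : 1 = 6%:R * (1 / 6) :> R by field.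
rewrite expRM_natl (@le_trans _ _ ((6 / 5) ^+ 6))//; last by lra.
by rewrite ler_pXn2r// ?nnegrE ?expR_ge0.
Qed.

Section runs.
Context {R : realType} {m n : nat}.
Variables (A : 'M[R]_(m, n)) (b : 'cV[R]_m) (c : 'cV[R]_n) (Kp : set 'cV[R]_n).
Variables (tau sigma beta : R) (z0 : 'cV[R]_(n + m)).
Notation run := (rPDHG A b c Kp tau sigma beta z0).
Notation first := (first_restart A b c Kp tau sigma beta).
Notation avg := (average A b c Kp tau sigma).

Lemma run0 zp z t : run 0 zp z t -> [/\ zp = z0, z = z0 & t = 0%N].
Proof. by move=> h; inversion h. Qed.

Lemma runS N z z' t' : run N.+1 z z' t' -> exists zp t k,
  [/\ run N zp z t, first N zp z k, z' = avg z k & t' = (t + k)%N].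
Proof. by move=> h; inversion h; subst; exists zp, t, k. Qed.

Lemma first_restart_unique N zp z k k' :
  first N zp z k -> first N zp z k' -> k = k'.
Proof.
move=> [k0 rk hk] [k0' rk' hk']; have [lt|lt|] := ltngtP k k'; last by [].
- by exfalso; apply: (hk' k) rk; rewrite k0.
- by exfalso; apply: (hk k') rk'; rewrite k0'.
Qed.

(** Determinism lets a failure to stop at a constructed state exclude every run reaching the same
    outer iteration. *)
Lemma run_unique N zp z t zp' z' t' : run N zp z t -> run N zp' z' t' ->
  [/\ zp = zp', z = z' & t = t'].
Proof.
elim: N zp z t zp' z' t' => [|N ih] zp z t zp' z' t'.
  by move=> /run0[-> -> ->] /run0[-> -> ->].
move=> /runS[p [s [k [h fk -> ->]]]] /runS[p' [s' [k' [h' fk' -> ->]]]].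
have [ep ez es] := ih _ _ _ _ _ _ h h'; subst.
by have -> := first_restart_unique fk fk'.
Qed.

Lemma first_restart_exists N zp z k : (0 < k)%N ->
  restart A b c Kp tau sigma beta N zp z k ->
  exists2 k', first N zp z k' & (k' <= k)%N.
Proof.
move=> k0 rk.
pose P := fun i => `[< (0 < i)%N /\ restart A b c Kp tau sigma beta N zp z i >].
have exP : exists i, P i by exists k; apply/asboolP.
have [i /asboolP[i0 ri] hi] := ex_minnP exP; exists i; last exact/hi/asboolP.
split=> // j /andP[j0 ji] rj.
have : P j by apply/asboolP.
by move=> /hi; rewrite leqNgt ji.
Qed.

End runs.

Section counting.
Context {R : realType} {m n : nat}.
Variables (A : 'M[R]_(m, n)) (b : 'cV[R]_m) (c : 'cV[R]_n) (Kp : set 'cV[R]_n).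
Hypothesis A_neq0 : A != 0.
Hypothesis (Kp_closed : closed Kp) (Kp_cone : convex_cone Kp).
Hypothesis c_null : A *m c = 0.
Variables (xS sS : 'cV[R]_n) (e : R).
Hypothesis (e0 : 0 < e) (xSV : Vp A b xS) (sSV : Vd A c sS).
Hypothesis (xS_int : forall x, enorm (x - xS) <= e -> Kp x).
Hypothesis (sS_int : forall s, enorm (s - sS) <= e -> Kd Kp s).
Variables (eps_cons eps_gap beta : R).
Hypothesis (eps_cons_gt0 : 0 < eps_cons) (eps_gap_gt0 : 0 < eps_gap).
Hypothesis beta0 : 0 < beta.
Variables (ws : 'cV[R]_(n + n)) (zs : 'cV[R]_(n + m)).
Hypothesis (wsW : Wstar A b c Kp ws).
Hypothesis (zsS : saddle A b c Kp zs) (zsD : dual_range A zs).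
Hypothesis (zsw : slack_point A c zs = ws).

Notation tau := (1 / kappa A).
Notation sigma := (1 / (lambda_max A * lambda_min A)).
Notation nM := (normM A tau sigma).
Notation q := (Num.sqrt (kappa A)).
Notation W := (slack_point A c).
Notation gapL := (gapL A b c).
Notation Gap := (Gap A b c).
Notation Wstar := (Wstar A b c Kp).
Notation avg := (average A b c Kp tau sigma).
Notation rho := (rho A b c Kp tau sigma).
Notation run := (rPDHG A b c Kp tau sigma beta 0).
Notation first := (first_restart A b c Kp tau sigma beta).

Let range := slater_range xSV.
Let ne := slater_ne e0 xS_int.
Let tau0 := tau_gt0 A_neq0.
Let sigma0 := sigma_gt0 A_neq0.
Let pM := psd_Mmx A_neq0.
Let q0 := sqrt_kappa_gt0 A_neq0.

Definition stops (z : 'cV[R]_(n + m)) :=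
  Econs A b c Kp (W z) <= eps_cons /\ Egap A b c (W z) <= eps_gap.

(** Pythagoras: the slack is [c - A^T y], and [c] is orthogonal to Im(A^T). *)
Lemma dual_part_le : enorm (A^T *m dsubmx zs) <= enorm (dsubmx ws).
Proof.
rewrite enorm_le -zsw col_mxKd; set y := dsubmx zs.
have cg : dotv c (A^T *m y) = 0 by rewrite dotv_mulmxr trmxK c_null dotv0l.
rewrite !dotv_lin (dotvC (A^T *m y) c) cg.
by have := dotv_ge0 c; lra.
Qed.

Lemma normM_zs : nM zs <= Num.sqrt 2 * q * enorm ws.
Proof.
rewrite (le_trans (normM_le A_neq0 zsD))// ler_wpM2l ?mulr_ge0 ?sqrtr_ge0//.
have -> : usubmx zs = usubmx ws by rewrite -zsw col_mxKu.
rewrite -(@ler_pXn2r _ 2) ?nnegrE ?enorm_ge0// sqr_enorm_col.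
rewrite -[ws in leRHS]vsubmxK sqr_enorm_col lerD2l.
by rewrite ler_pXn2r ?nnegrE ?enorm_ge0// dual_part_le.
Qed.

Lemma Gap0 : Gap (W 0) = 0.
Proof. by rewrite (Gap_col c_null range) !linear0 !dotv0r subrr. Qed.

(** The origin gives the pair [(0, c)] with gap 0. Replacing its first half by that of [ws] reaches
    the affine space, replacing its second half reaches the cone, and each change is at most
    [|ws|]. *)
Lemma stops0 : enorm ws <= eps_cons -> stops 0.
Proof.
move=> wse; split; last by rewrite /Egap Gap0 maxxx ltW.
have [[[wV1 wV2] [wK1 wK2]] _] := wsW.
have [y sE _] := Vd_dual wV2.
rewrite /Econs ge_max; apply/andP; split.
  have h : Vpd A b c (col_mx (usubmx ws) (c - A^T *m 0)).
    split; rewrite ?col_mxKu ?col_mxKd//.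
    by exists 0; rewrite !mulmx0 subr0 addr0.
  rewrite (le_trans (dist_le _ h))// /slack_point !linear0 ?mulmx0 ?linear0.
  rewrite opp_col_mx add_col_mx sub0r subrr (le_trans (enorm_col_le _ _))//.
  by rewrite enorm0 addr0 enormN (le_trans (enorm_usub _)).
have h : Kpd Kp (col_mx 0 (dsubmx ws)).
  by split; rewrite ?col_mxKu ?col_mxKd//; exact: cone0.
rewrite (le_trans (dist_le _ h))// /slack_point !linear0 ?mulmx0 ?linear0.
rewrite opp_col_mx add_col_mx subrr (le_trans (enorm_col_le _ _))// enorm0 add0r.
apply: le_trans wse; apply: le_trans (enorm_dsub _); apply: le_trans dual_part_le.
by rewrite -zsw col_mxKd ?oppr0 ?subr0 ?addr0 subKr.
Qed.

Lemma saddle_stops z : saddle A b c Kp z -> stops z.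
Proof.
move=> /(saddleP Kp_cone ne c_null range)[[zV zK] /= g0]; split.
  rewrite /Econs ge_max; apply/andP; split.
    by rewrite (le_trans (dist_le _ zV))// subrr enorm0 ltW.
  by rewrite (le_trans (dist_le _ zK))// subrr enorm0 ltW.
by rewrite /Egap g0 maxxx ltW.
Qed.

Lemma run_invariant N zp z t : run N zp z t ->
  [/\ dual_range A z, Kp (usubmx z), nM (z - zs) <= nM zs &
      nM (zp - zs) <= nM zs].
Proof.
elim=> [|{}N {}zp {}z {}t k _ [zr Kz hz _] [k0 _ _]].
  rewrite sub0r (normMN pM); split=> //; first exact: dual_range0.
  by rewrite linear0; exact: cone0.
split=> //.
- exact: (dual_range_avg c Kp tau sigma range k zr).
- exact: (usub_avg A b c tau sigma Kp_closed Kp_cone ne z k0).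
- exact: le_trans (avg_fejer Kp_closed Kp_cone ne tau0 sigma0 pM z k0 zsS) hz.
Qed.

Lemma normM_run N zp z t : run N zp z t ->
  nM (z - zp) <= 2 * nM zs /\ nM z <= 2 * nM zs.
Proof.
move=> /run_invariant[_ _ hz hzp]; split.
  have := normM_triangle pM z zs zp; rewrite (normMB pM zs zp); lra.
have := normM_triangle pM z zs 0; rewrite !subr0; lra.
Qed.

Section state.
Variables (N : nat) (zp z : 'cV[R]_(n + m)) (t : nat) (p : R).
Hypothesis zrun : run N zp z t.
Hypothesis r0 : 0 < nM (z - zp).
Hypothesis rhop : (rho (nM (z - zp)) z <= p%:E)%E.

Let Kz : Kp (usubmx z).
Proof. by case: (run_invariant zrun). Qed.

Let hz zh : Kp (usubmx zh) -> nM (zh - z) <= nM (z - zp) ->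
  gapL z zh <= p * nM (z - zp).
Proof. move=> Kzh; exact: (rho_bound r0 rhop Kzh). Qed.

(** Restart points stay within [nM zs] of [zs], so the restart radius and the M-norm of [z] are both
    at most [2 * nM zs]. *)
Lemma Gap_run_le : Gap (W z) <= 2 * Num.sqrt 2 * q * p * enorm ws.
Proof.
have p0 := gap_bound_ge0 r0 Kz hz; have [h1 h2] := normM_run zrun.
rewrite (le_trans (Gap_le_rho A_neq0 Kp_cone ne c_null range r0 Kz hz))//.
have h : Num.max (nM (z - zp)) (nM z) <= 2 * (Num.sqrt 2 * q * enorm ws).
  by have := normM_zs; rewrite ge_max => h; apply/andP; split; lra.
by rewrite (le_trans (ler_wpM2l p0 h))//; lra.
Qed.

Lemma residuals_stop : q * p <= eps_cons ->
  2 * Num.sqrt 2 * q * p * enorm ws <= eps_gap -> stops z.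
Proof.
move=> hc hg; split; last first.
  by rewrite /Egap ge_max ltW//= (le_trans Gap_run_le).
apply: le_trans hc; rewrite /Econs ge_max; apply/andP; split.
  have [x' [x'V _] hx'] := projection_Vp A_neq0 c_null range (usubmx z).
  have l0 := lambda_min_gt0 A_neq0.
  have h : Vpd A b c (col_mx x' (c - A^T *m dsubmx z)).
    by split; rewrite ?col_mxKu ?col_mxKd//; exists (- dsubmx z); rewrite mulmxN.
  rewrite (le_trans (dist_le _ h))// opp_col_mx add_col_mx subrr.
  rewrite (le_trans (enorm_col_le _ _))// enorm0 addr0 -(ler_pM2l l0).
  rewrite (le_trans hx')// (le_trans (primal_residual A_neq0 r0 Kz hz))//.
  by rewrite mulrA (mulrC q).
have hd := dual_residual A_neq0 Kp_closed Kp_cone ne r0 Kz hz.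
rewrite /slack_point; set s := c - A^T *m dsubmx z in hd *.
have h : Kpd Kp (col_mx (usubmx z) (s + eproj Kp (- s))).
  split; rewrite ?col_mxKu ?col_mxKd//.
  exact: dual_cone_proj Kp_closed Kp_cone ne _.
rewrite (le_trans (dist_le _ h))// opp_col_mx add_col_mx subrr.
rewrite (le_trans (enorm_col_le _ _))// enorm0 add0r.
have -> : s - (s + eproj Kp (- s)) = - eproj Kp (- s) by rewrite opprD addNKr.
by rewrite enormN.
Qed.

(** The comparison saddle [y] depends on [z]: it is the one supplied by the error bound. Here [p] is
    the exact value of [rho]: its upper bound feeds the error bound, its lower bound the restart
    test. *)
Lemma inner_restart (l' : R) k : (0 < N)%N -> 0 < enorm ws -> (0 < k)%N ->
  (liminf_level_ratio A b c Kp < l'%:E)%E ->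
  4 * Num.sqrt 2 * kappa A * (3 * Num.sqrt 2 * l' + 1) <= beta * k%:R ->
  (p%:E <= rho (nM (z - zp)) z)%E ->
  restart A b c Kp tau sigma beta N zp z k.
Proof.
move=> N0 ws0 k0 hl hk hp; right; split=> //.
have p0 := gap_bound_ge0 r0 Kz hz.
apply: (@le_trans _ _ (beta * p)%:E); last first.
  by rewrite EFinM lee_pmul2l ?lte_fin.
(* At radius 0 the convention [0^-1 = 0] makes [rho] vanish, so the test succeeds. *)
have [rk0|rk0] := eqVneq (nM (avg z k - z)) 0.
  by rewrite rk0 /Defs.rho invr0 mul0e lee_fin mulr_ge0// ltW.
have {}rk0 : 0 < nM (avg z k - z) by rewrite lt_def rk0 normM_ge0.
rewrite (le_trans (rho_avg Kp_closed Kp_cone ne tau0 sigma0 pM k0 rk0))//.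
rewrite lee_fin ler_pdivrMr ?ltr0n//.
have [w wW hw] := error_bound A_neq0 Kp_closed Kp_cone c_null e0 xSV sSV
  xS_int sS_int wsW ws0 r0 Kz hz Gap_run_le hl.
have [y [yS yD yw]] := Wstar_saddle c_null range wW.
have [zD _ _ _] := run_invariant zrun.
have h1 := avg_fejer Kp_closed Kp_cone ne tau0 sigma0 pM z k0 yS.
have h2 := normM_triangle pM (avg z k) y z.
rewrite (normMB pM y z) in h2.
have h3 := normM_slack c A_neq0 zD yD; rewrite yw in h3.
have s0 : 0 <= Num.sqrt 2 * q by rewrite mulr_ge0 ?sqrtr_ge0.
have h4 := ler_wpM2l s0 hw.
have h5 := ler_wpM2r p0 hk.
have h6 : Num.sqrt 2 * q * ((3 * Num.sqrt 2 * l' + 1) * (q * p)) =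
  Num.sqrt 2 * kappa A * (3 * Num.sqrt 2 * l' + 1) * p.
  by rewrite -[in RHS](sqr_sqrt_kappa A_neq0); ring.
rewrite h6 in h4; lra.
Qed.

End state.

(** The budget counts one inner iteration for outer iteration 0, which restarts at [k = 1] by
    definition, and at most [K] for each later one. Positivity of the radius is carried along
    because [rho] at radius 0 bounds nothing. *)
Lemma outer_loop (l' : R) K j : 0 < enorm ws -> (0 < K)%N ->
  (liminf_level_ratio A b c Kp < l'%:E)%E ->
  4 * Num.sqrt 2 * kappa A * (3 * Num.sqrt 2 * l' + 1) <= beta * K%:R ->
  (exists N zp z t, [/\ run N zp z t, stops z,
     (forall N' zp' z' t', (N' < N)%N -> run N' zp' z' t' -> ~ stops z') &
     (t <= 1 + j * K)%N]) \/
  (exists zp z t, [/\ run j.+1 zp z t,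
     (forall N' zp' z' t', (N' <= j.+1)%N -> run N' zp' z' t' -> ~ stops z'),
     (t <= 1 + j * K)%N, 0 < nM (z - zp) &
     (rho (nM (z - zp)) z <=
        (beta ^+ j * (4 * (Num.sqrt 2 * q * enorm ws)))%:E)%E]).
Proof.
move=> ws0 K0 hl hK.
have next N zp z t k : run N zp z t -> first N zp z k ->
    (forall N' zp' z' t', (N' <= N)%N -> run N' zp' z' t' -> ~ stops z') ->
    (exists N zp z t', [/\ run N zp z t', stops z,
       (forall N' zp' z' t', (N' < N)%N -> run N' zp' z' t' -> ~ stops z') &
       (t' = t + k)%N]) \/
    [/\ run N.+1 z (avg z k) (t + k)%N,
     (forall N' zp' z' t', (N' <= N.+1)%N -> run N' zp' z' t' -> ~ stops z') &
     0 < nM (avg z k - z)].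
  move=> zrun fk hN; have zrun' := rPDHG_restart zrun fk.
  have [hs|hs] := pselect (stops (avg z k)).
    by left; exists N.+1, z, (avg z k), (t + k)%N.
  right; split=> //.
    move=> N' zp' z' t'; rewrite leq_eqVlt => /orP[/eqP ->|]; last exact: hN.
    by move=> h; have [_ <- _] := run_unique zrun' h.
  (* A zero radius would make the average a saddle point, where the run stops. *)
  rewrite lt_def normM_ge0 andbT; apply/negP => /eqP r0; apply: hs.
  by case: fk => k0 _ _; apply/saddle_stops/(avg_saddle _ _ _ _ _ _ k0 r0).
elim: j => [|j [ih|[zp [z [t [zrun hN ht r0 rhop]]]]]].
- have init : run 0 0 0 0 by constructor.
  have [hs|hs] := pselect (stops 0).
    by left; exists 0%N, 0, 0, 0%N.
  have f1 : first 0 0 0 1.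
    by split=> //; [left|move=> i /andP[]; case: i].
  have hN0 N' zp' z' t' : (N' <= 0)%N -> run N' zp' z' t' -> ~ stops z'.
    by rewrite leqn0 => /eqP -> /run0[_ -> _].
  have [[N [zp [z [t [h1 h2 h3 h4]]]]]|[h1 h2 h3]] := next _ _ _ _ _ init f1 hN0.
    by left; exists N, zp, z, t; split=> //; rewrite h4.
  right; exists 0, (avg 0 1), 1%N; split=> //.
  (* One step gives a normalized gap at most twice its radius, and that radius is at most
     [2 * nM zs]: hence the factor 4. *)
  have [h4 _] := normM_run h1.
  rewrite (le_trans (rho_avg Kp_closed Kp_cone ne tau0 sigma0 pM _ h3))//.
  have h5 := normM_zs; rewrite lee_fin.
  move: (nM (avg 0 1 - 0)) (nM zs) (Num.sqrt 2 * q * enorm ws) h4 h5.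
  by move=> r s B; lra.
- left; have [N [zp [z [t [h1 h2 h3 h4]]]]] := ih; exists N, zp, z, t; split=> //.
  by rewrite (leq_trans h4)// leq_add2l leq_mul2r leqnSn orbT.
have [p rp] : exists p : R, rho (nM (z - zp)) z = p%:E.
  have [_ Kz _ _] := run_invariant zrun.
  move: rhop (rho_ge0 A b c tau sigma r0 Kz).
  by case: (rho _ z) => [p| |] //; exists p.
have rk : restart A b c Kp tau sigma beta j.+1 zp z K.
  by apply: (@inner_restart _ _ _ t p) hK _; rewrite ?rp.
have [k fk kK] := first_restart_exists K0 rk.
have tk : (t + k <= 1 + j.+1 * K)%N.
  by rewrite mulSnr addnA leq_add.
have [[N [zp' [z' [t' [h1 h2 h3 h4]]]]]|[h1 h2 h3]] := next _ _ _ _ _ zrun fk hN.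
  by left; exists N, zp', z', t'; split=> //; rewrite h4.
right; exists z, (avg z k), (t + k)%N; split=> //.
case: fk => _ [[]//|[_ h]] _; rewrite (le_trans h)// exprS -mulrA EFinM.
by rewrite lee_pmul2l ?lte_fin.
Qed.

End counting.

(** * Numerical constants and the final estimate *)

Lemma sqrt2_le (R : realType) : Num.sqrt 2 <= 17 / 12 :> R.
Proof.
have s2 : Num.sqrt 2 ^+ 2 = 2 :> R by rewrite sqr_sqrtr.
by rewrite -(@ler_pXn2r _ 2) ?nnegrE ?s2 ?sqrtr_ge0//; lra.
Qed.

(** The origin of 17 in the logarithm: it exceeds [4 * sqrt 2 * 3], where 3 bounds [e]. *)
Lemma sqrt2_div17_le (R : realType) : 4 * Num.sqrt 2 / 17 * 3 <= 1 :> R.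
Proof. by have := sqrt2_le R; lra. Qed.

(** [12 * 2 * 21/20 = 25.2] plus [4 sqrt 2 < 5.7], times 3 for [e], plus 1 for rounding up, stays
    below 97 once [k <= k * l]. *)
Lemma iteration_constants (R : realType) (k l : R) : 1 <= k -> 1 <= l ->
  4 * Num.sqrt 2 * k * (3 * Num.sqrt 2 * (21 / 20 * l) + 1) * expR 1 + 1 <=
  97 * k * l.
Proof.
move=> k1 l1; have s2 : Num.sqrt 2 ^+ 2 = 2 :> R by rewrite sqr_sqrtr.
have s0 : 0 <= Num.sqrt 2 :> R by rewrite sqrtr_ge0.
have e3 := expR1_le3 R.
move: (Num.sqrt 2) s2 s0 (sqrt2_le R) => s s2 s0 s1.
have kl : 1 <= k * l by rewrite -[1]mulr1 ler_pM.
have -> : 4 * s * k * (3 * s * (21 / 20 * l) + 1) * expR 1 =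
    (4 * 3 * (21 / 20) * s ^+ 2 * (k * l) + 4 * s * k) * expR 1 by field.
rewrite s2.
have k0 : 0 <= k := le_trans ler01 k1.
have kkl : k <= k * l by rewrite ler_peMr.
have h1 := ler_wpM2r k0 s1.
have h2 : 0 <= s * k by rewrite mulr_ge0.
set X := (X in X * expR 1); have X0 : 0 <= X by rewrite /X; lra.
have := ler_wpM2l X0 e3; rewrite {2}/X; lra.
Qed.

Lemma iteration_total (R : realType) (t y x u : R) :
  t <= 1 + y -> y <= x * (97 * u) -> 1 <= x * u -> t <= 99 * u * x.
Proof. by move=> h1 h2 h3; lra. Qed.

Lemma gap_scaling (R : realType) (q p s d : R) :
  2 * s * q * p * d = q * p * (2 * s * d).
Proof. by ring. Qed.

Lemma rho_scaling (R : realType) (q bJ s d M : R) :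
  q * (bJ * (4 * (s * q * d))) * M =
  4 * s / 17 * (bJ * (17 * q ^+ 2 * d * M)).
Proof. by field. Qed.

(* The maximum with 0 matters only when the argument of [ln] is below 1; the
   initial point then already meets both tolerances, so T = 0 while the bound is
   negative. *)
Theorem corollary3p1 (R : realType) (m n : nat)
    (A : 'M[R]_(m, n)) (b : 'cV[R]_m) (c : 'cV[R]_n) (Kp : set 'cV[R]_n)
    (eps_cons eps_gap : R)
    (A_neq0 : A != 0)
    (Kp_closed : closed Kp)
    (Kp_cone : convex_cone Kp)
    (primal_slater : exists x, Vp A b x /\ interior Kp x)
    (dual_slater : exists s, Vd A c s /\ interior (Kd Kp) s)
    (c_null : A *m c = 0)
    (eps_cons_gt0 : 0 < eps_cons)
    (eps_gap_gt0 : 0 < eps_gap) :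
  let k := kappa A in
  let tau0 := 1 / k in
  let sigma0 := 1 / (lambda_max A * lambda_min A) in
  let beta := 1 / expR 1 in
  let stop := [set z : 'cV[R]_(n + m) |
    Econs A b c Kp (slack_point A c z) <= eps_cons /\
    Egap A b c (slack_point A c z) <= eps_gap] in
  let T := iteration_count A b c Kp tau0 sigma0 beta 0 stop in
  let D := dist 0 (Wstar A b c Kp) in
  (T <= maxe 0
    ((99 * k)%:E * liminf_level_ratio A b c Kp *
     (ln (17 * k * D *
        Num.max (1 / eps_cons) (2 * Num.sqrt 2 * D / eps_gap)))%:E))%E.
Proof.
cbv zeta; set k := kappa A; set tau0 := 1 / k; set sigma0 := 1 / (_ * _).
set beta := 1 / expR 1; set stop : set 'cV[R]_(n + m) := mkset _.
set T := iteration_count _ _ _ _ _ _ _ _ _; set D := dist _ _.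
have [xS [xSV /interior_enorm[e1 e10 xSi]]] := primal_slater.
have [sS [sSV /interior_enorm[e2 e20 sSi]]] := dual_slater.
pose e := Num.min e1 e2; have e0 : 0 < e by rewrite lt_min e10.
have xS_int x : enorm (x - xS) <= e -> Kp x.
  by move=> h; apply: xSi; rewrite (le_trans h)// ge_min lexx.
have sS_int s : enorm (s - sS) <= e -> Kd Kp s.
  by move=> h; apply: sSi; rewrite (le_trans h)// ge_min lexx orbT.
have [ws wsW wsmin] := Wstar_min A_neq0 Kp_closed Kp_cone c_null e0 xSV sSV
  xS_int sS_int.
have [zs [zsS zsD zsw]] := Wstar_saddle c_null (slater_range xSV) wsW.
have DE : D = enorm ws.
  rewrite /D (@distE _ _ _ _ ws)//; first by rewrite sub0r enormN.
  by move=> v /wsmin; rewrite !sub0r !enormN.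
have k1 : 1 <= k := kappa_ge1 A_neq0.
have k0 : 0 < k := lt_le_trans ltr01 k1.
have T_le N zp z t : rPDHG A b c Kp tau0 sigma0 beta 0 N zp z t -> stop z ->
    (forall N' zp' z' t', (N' < N)%N ->
      rPDHG A b c Kp tau0 sigma0 beta 0 N' zp' z' t' -> ~ stop z') ->
    (T <= (t%:R)%:E)%E.
  move=> h1 h2 h3; apply: ereal_inf_lbound; exists t => //.
  by exists N, zp, z.
set M := Num.max _ _; set X := 17 * k * D * M.
have D0 : 0 <= D by rewrite DE enorm_ge0.
have M1 : 1 / eps_cons <= M by rewrite le_max lexx.
have M2 : 2 * Num.sqrt 2 * D / eps_gap <= M by rewrite le_max lexx orbT.
(* If [X <= 17] then [k * D * M <= 1], so [D <= eps_cons] and the origin already stops; otherwise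
   [X > e], which gives [ln X >= 1]. *)
have [X17|X17] := leP X 17.
  rewrite le_max; apply/orP; left.
  have kDM : k * D * M <= 1 by move: X17; rewrite /X; lra.
  have wse : enorm ws <= eps_cons.
    rewrite -DE -[leRHS]mul1r -ler_pdivrMr//.
    have kD : 0 <= k * D by rewrite mulr_ge0// ltW.
    have h1 := ler_wpM2l kD M1.
    have h2 : D / eps_cons <= k * D * (1 / eps_cons).
      by rewrite mulrA mulr1 ler_pM2r ?invr_gt0// ler_peMl.
    by rewrite (le_trans h2)// (le_trans h1).
  have s0 := stops0 Kp_cone c_null e0 xSV xS_int eps_gap_gt0 wsW zsw wse.
  by apply: (T_le 0%N 0 0 0%N) => //; exact: rPDHG_init.
have e3 := expR1_le3 R.
have ep : 0 < expR 1 :> R := expR_gt0 1.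
have X0 : 0 < X by rewrite (lt_trans _ X17).
have lnX : 1 <= ln X.
  by rewrite -[leLHS]expRK ler_ln ?posrE//; lra.
have l1 := liminf_ge1 Kp_cone c_null e0 xSV sSV xS_int sS_int.
have wsp : 0 < enorm ws.
  rewrite -DE lt_def D0 andbT; apply: contraTneq X0 => D00.
  by rewrite /X D00 mulr0 mul0r ltxx.
have {}l1 := l1 _ wsW wsp.
rewrite le_max; apply/orP; right.
(* The value -oo contradicts [l1]; for +oo the right-hand side is +oo because its other factors are
   positive. *)
case El : (liminf_level_ratio A b c Kp) l1 => [l| |] l1; last first.
- by rewrite leNgt ltNyr in l1.
- have k99 : 0 < 99 * k by lra.
  rewrite gt0_muley ?lte_fin//.
  by rewrite gt0_mulye ?leey// lte_fin (lt_le_trans ltr01).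
rewrite lee_fin in l1.
(* Any value above the liminf works; the factor 21/20 fits in the slack of the
   constant 99. *)
pose l' := 21 / 20 * l.
have ll' : (liminf_level_ratio A b c Kp < l'%:E)%E.
  by rewrite El lte_fin /l'; lra.
pose C := 4 * Num.sqrt 2 * k * (3 * Num.sqrt 2 * l' + 1) * expR 1.
have l'0 : 0 <= l' by rewrite /l'; lra.
have s0 : 0 <= Num.sqrt 2 :> R by rewrite sqrtr_ge0.
have sl0 : 0 <= 3 * Num.sqrt 2 * l' + 1.
  exact: addr_ge0 (mulr_ge0 (mulr_ge0 (ler0n _ 3) s0) l'0) ler01.
have s40 : 0 <= 4 * Num.sqrt 2 :> R by rewrite mulr_ge0.
have C0 : 0 <= C.
  exact: mulr_ge0 (mulr_ge0 (mulr_ge0 s40 (ltW k0)) sl0) (ltW ep).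
pose K := (Num.truncn C).+1.
have /andP[C1 C2] := truncn_itv C0.
have KC : K%:R <= 97 * k * l.
  apply: le_trans (iteration_constants k1 l1).
  have -> : K%:R = (Num.truncn C)%:R + 1 :> R by rewrite natr1.
  by rewrite lerD2r.
have hK : 4 * Num.sqrt 2 * k * (3 * Num.sqrt 2 * l' + 1) <= beta * K%:R.
  have -> : beta * K%:R = K%:R / expR 1 by rewrite /beta div1r mulrC.
  by rewrite ler_pdivlMr// ltW.
(* Subtracting 1 before rounding keeps [J <= ln X]; the cost is that [beta ^+ J * X] is only below
   [e], not below 1, and 17 pays for it. *)
pose J := (Num.truncn (ln X - 1)).+1.
have lnX1 : 0 <= ln X - 1 by rewrite subr_ge0.
have /andP[J1 J2] := truncn_itv lnX1.
have beta0 : 0 < beta by rewrite divr_gt0.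
have bJ : beta ^+ J * X <= expR 1.
  have -> : beta ^+ J = expR (- J%:R).
    by rewrite expRN -[J%:R]mulr1 expRM_natl /beta expr_div_n expr1n div1r.
  rewrite -{1}(lnK X0) -expRD ler_expR; move: J2; rewrite -/J; lra.
have := outer_loop A_neq0 Kp_closed Kp_cone c_null e0 xSV sSV xS_int sS_int
  eps_cons_gt0 eps_gap_gt0 beta0 wsW zsS zsD zsw J wsp (ltn0Sn _) ll' hK.
case=> [[N [zp [z [t [h1 h2 h3 h4]]]]]|[zp [z [t [h1 h2 h3 r0 hr]]]]].
  rewrite (le_trans (T_le _ _ _ _ h1 h2 h3))// -!EFinM lee_fin -(mulrA 99).
  have kl : 1 <= k * l by rewrite -[1]mulr1 ler_pM.
  have tJK : t%:R <= 1 + J%:R * K%:R :> R.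
    have -> : 1 + J%:R * K%:R = (1 + J * K)%N%:R :> R by rewrite natrD natrM.
    by rewrite ler_nat.
  have JX : J%:R <= ln X.
    have -> : J%:R = (Num.truncn (ln X - 1))%:R + 1 :> R by rewrite natr1.
    by rewrite -lerBrDr.
  have h5 : J%:R * K%:R <= ln X * (97 * (k * l)) by rewrite ler_pM// mulrA.
  have h6 : 1 <= ln X * (k * l) by rewrite -[1]mulr1 ler_pM.
  exact: iteration_total tJK h5 h6.
(* After [J] contractions the gap [p] satisfies [q * p * M <= 1]; since [M] dominates both scaled
   reciprocal tolerances, [z] stops, contrary to [h2]. *)
exfalso; apply: (h2 _ _ _ _ (leqnn _) h1).
set p := beta ^+ J * _ in hr.
have q2 := sqr_sqrt_kappa A_neq0; rewrite -/k in q2.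
set q := Num.sqrt k in q2 p hr.
have s2 : Num.sqrt 2 ^+ 2 = 2 :> R by rewrite sqr_sqrtr.
have qpM : q * p * M <= 1.
  have -> : q * p * M = 4 * Num.sqrt 2 / 17 * (beta ^+ J * X).
    have -> : X = 17 * q ^+ 2 * enorm ws * M by rewrite q2 -DE.
    exact: rho_scaling.
  have h : 0 <= 4 * Num.sqrt 2 / 17 :> R by rewrite divr_ge0.
  rewrite (le_trans (ler_wpM2l h bJ))// (le_trans (ler_wpM2l h e3))//.
  exact: sqrt2_div17_le.
have qp0 : 0 <= q * p.
  rewrite mulr_ge0 ?sqrtr_ge0// /p mulr_ge0 ?exprn_ge0 ?(ltW beta0)//.
  by rewrite !mulr_ge0 ?sqrtr_ge0 ?enorm_ge0.
have := residuals_stop A_neq0 Kp_closed Kp_cone c_null e0 xSV xS_int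
  eps_gap_gt0 zsS zsD zsw h1 r0 hr.
apply.
- have := le_trans (ler_wpM2l qp0 M1) qpM.
  by rewrite mulrA mulr1 ler_pdivrMr// mul1r.
- have := le_trans (ler_wpM2l qp0 M2) qpM.
  rewrite mulrA ler_pdivrMr// mul1r DE; apply: le_trans.
  by rewrite gap_scaling.
Qed.
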